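(* Let $\ell\ge 1$ and $n,m_1,\dots,m_\ell$ be positive integers, $m:=\sum_{i=1}^\ell m_i$. For $i=1,\dots,\ell$ let $C_i\subseteq\mathbb{R}^{m_i}$ be a nonempty closed convex set and $A_i\in\mathbb{R}^{m_i\times n}$ a nonzero matrix, and let $\bar v\in\mathbb{R}^n$, with $\bigcap_{i=1}^\ell A_i^{-1}C_i\neq\emptyset$. Let $x^*$ be the unique solution of $\min_x\frac12\|x-\bar v\|^2$ subject to $A_ix\in C_i$, $i=1,\dots,\ell$. Suppose: (a) each $C_i$ is a $C^{1,\alpha}$-cone reducible closed convex set, for some $\alpha\in(0,1]$; (b) $\bigcap_{i=1}^\ell A_i^{-1}\operatorname{ri}C_i\neq\emptyset$; (c) $0\in x^*-\bar v+\operatorname{ri}\partial\big(\sum_{i=1}^\ell\delta_{A_i^{-1}C_i}\big)(x^* )$. Let $d(\mathbf y):=\frac12\|\sum_{i=1}^\ell A_i^Ty_i-\bar v\|^2-\frac12\|\bar v\|^2+\sum_{i=1}^\ell\sigma_{C_i}(y_i)$ for $\mathbf y=(y_1,\dots,y_\ell)\in\mathbb{R}^m$, $d^*:=\inf d$, and let $\{x^t\},\{\mathbf y^t\}$ be generated by the following algorithm: set $\gamma_i:=\lambda_{\max}(A_i^TA_i)$, $y_i^0:=0$, $x^0:=x^0_\ell:=\bar v$; for $t=0,1,2,\dots$ set $x^{t+1}_0:=x^t_\ell$ and for $i=1,\dots,\ell$ compute $$x^{t+1}_i=(I-\gamma_i^{-1}A_i^TA_i)x^{t+1}_{i-1}+\gamma_i^{-1}A_i^T\operatorname{Proj}_{C_i}(\gamma_iy_i^t+A_ix^{t+1}_{i-1}),$$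 $$y^{t+1}_i=y_i^t+\gamma_i^{-1}A_ix^{t+1}_{i-1}-\gamma_i^{-1}\operatorname{Proj}_{C_i}(\gamma_iy^t_i+A_ix^{t+1}_{i-1}),$$ then set $x^{t+1}:=x^{t+1}_\ell$ and $\mathbf y^{t+1}:=(y^{t+1}_1,\dots,y^{t+1}_\ell)$. Then $x^t\to x^*$ and $\operatorname{dist}(\mathbf y^t,\operatorname{Argmin} d)\to0$. Moreover: (i) if each $C_i$ is $C^{1,1}$-cone reducible, there exist $\mathbf y^*\in\operatorname{Argmin} d$, $a_1>0$, $a_0\in(0,1)$ and a positive integer $\bar t$ such that $\|x^t-x^*\|\le a_1a_0^t$ and $\|\mathbf y^t-\mathbf y^*\|\le a_1a_0^t$ for all $t\ge\bar t$; (ii) if each $C_i$ is $C^{1,\alpha}$-cone reducible with $\alpha\in(0,1)$, then, with $\theta:=\frac1{1+\alpha}\in(\frac12,1)$, there exist $a_1>0$ and a positive integer $\bar t$ such that for all $t\ge\bar t$, $$\|x^t-x^*\|\le a_1t^{-\frac\alpha2\cdot\frac{1-\theta}{2\theta-1}},\quad d(\mathbf y^t)-d^*\le a_1t^{-\frac{1-\theta}{2\theta-1}},\quad\operatorname{dist}(\mathbf y^t,\operatorname{Argmin} d)\le a_1t^{-\frac\alpha2\cdot\frac{1-\theta}{2\theta-1}}.$$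
   Context: $A_i^{-1}S:=\{x:A_ix\in S\}$; $\operatorname{ri}$ is relative interior; $\delta_S$ is the indicator function of $S$; $\sigma_C(y)=\sup_{u\in C}\langle y,u\rangle$; $\operatorname{Proj}_C$ is the Euclidean projection onto $C$; $\lambda_{\max}$ the largest eigenvalue. $C^{1,\alpha}$-cone reducibility: a closed set $\mathfrak D\subseteq\mathbb{R}^k$ is $C^{1,\alpha}$-cone reducible at $\hat x\in\mathfrak D$ if there are $\rho>0$, a closed convex pointed cone $K$ in a finite-dimensional Hilbert space $\mathbb Y$ and a map $\Xi:\mathbb{R}^k\to\mathbb Y$ with $\Xi(\hat x)=0$, continuously differentiable on $B(\hat x,\rho)$, with $D\Xi(\hat x)$ surjective, $x\mapsto D\Xi(x)$ $\alpha$-Hölder continuous on $B(\hat x,\rho)$, and $\mathfrak D\cap B(\hat x,\rho)=\{x:\Xi(x)\in K\}\cap B(\hat x,\rho)$; it is $C^{1,\alpha}$-cone reducible if this holds at every point of $\mathfrak D$. *)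

(* Defs.v *)
From HB Require Import structures.
From mathcomp Require Import all_boot all_order all_algebra.
From mathcomp Require Import all_classical all_reals all_analysis.
Set Implicit Arguments. Unset Strict Implicit. Unset Printing Implicit Defensive.
Import Order.TTheory GRing.Theory Num.Theory.
Import numFieldNormedType.Exports.
Local Open Scope classical_set_scope.
Local Open Scope ring_scope.

Section Defs.
Variable R : realType.

Definition inner k (a b : 'cV[R]_k) : R := \sum_(j < k) a j ord0 * b j ord0.
Definition enorm k (a : 'cV[R]_k) : R := Num.sqrt (inner a a).
Definition eball k (c : 'cV[R]_k) (r : R) : set 'cV[R]_k :=
  [set x | enorm (x - c) < r].

Definition aff k (S : set 'cV[R]_k) : set 'cV[R]_k :=
  [set z | exists (N : nat) (p : 'I_N -> 'cV[R]_k) (c : 'I_N -> R),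
     (forall j, S (p j)) /\ \sum_(j < N) c j = 1 /\ z = \sum_(j < N) c j *: p j].
Definition ri k (S : set 'cV[R]_k) : set 'cV[R]_k :=
  [set x | S x /\ exists e : R, 0 < e /\ (eball x e `&` aff S) `<=` S].

Definition mxpre k n (A : 'M[R]_(k, n)) (S : set 'cV[R]_k) : set 'cV[R]_n :=
  [set x | S (A *m x)].

Definition delta_ind k (S : set 'cV[R]_k) (x : 'cV[R]_k) : \bar R :=
  if `[< S x >] then 0%E else +oo%E.

Definition subdiff k (f : 'cV[R]_k -> \bar R) (x : 'cV[R]_k) : set 'cV[R]_k :=
  [set g | f x \is a fin_num /\
           forall y, (f x + (inner g (y - x))%:E <= f y)%E].

Definition supp_fun k (C : set 'cV[R]_k) (y : 'cV[R]_k) : \bar R :=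
  ereal_sup [set (inner y u)%:E | u in C].

Definition is_proj k (C : set 'cV[R]_k) (z p : 'cV[R]_k) : Prop :=
  C p /\ forall u, C u -> enorm (z - p) <= enorm (z - u).
Definition proj_set k (C : set 'cV[R]_k) (z : 'cV[R]_k) : 'cV[R]_k :=
  xget 0 [set p | is_proj C z p].

Definition lambda_max k (M : 'M[R]_k) : R :=
  xget 0 [set a | eigenvalue M a /\ forall b, eigenvalue M b -> b <= a].

Definition closed_convex_pointed_cone p (K : set 'cV[R]_p) : Prop :=
  closed K /\ convex_set K /\ K 0 /\
  (forall (lam : R) x, 0 <= lam -> K x -> K (lam *: x)) /\
  (forall x, K x -> K (- x) -> x = 0).

(* C^{1,alpha}-cone reducibility at a point (Y taken as R^p) *)
Definition cone_reducible_at (alpha : R) k (D : set 'cV[R]_k) (xh : 'cV[R]_k) :=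
  exists (rho : R) (p : nat) (K : set 'cV[R]_p) (Xi : 'cV[R]_k -> 'cV[R]_p),
    0 < rho /\ closed_convex_pointed_cone K /\ Xi xh = 0 /\
    (forall x, eball xh rho x -> differentiable Xi x) /\
    (forall x, eball xh rho x -> forall eps : R, 0 < eps -> exists del : R, 0 < del /\
        forall y, eball xh rho y -> enorm (y - x) < del ->
        forall h, enorm ('d Xi y h - 'd Xi x h) <= eps * enorm h) /\
    (forall w : 'cV[R]_p, exists h : 'cV[R]_k, 'd Xi xh h = w) /\
    (exists L : R, 0 <= L /\ forall x y, eball xh rho x -> eball xh rho y ->
        forall h, enorm ('d Xi x h - 'd Xi y h) <= L * powR (enorm (x - y)) alpha * enorm h) /\
    D `&` eball xh rho = [set x | K (Xi x)] `&` eball xh rho.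

Definition cone_reducible (alpha : R) k (D : set 'cV[R]_k) :=
  closed D /\ forall xh, D xh -> cone_reducible_at alpha D xh.

(* stacked dual variables y = (y_1,...,y_l) in R^m, m = sum m_i *)
Definition ynorm l (m : 'I_l -> nat) (y : forall i : 'I_l, 'cV[R]_(m i)) : R :=
  Num.sqrt (\sum_(i < l) inner (y i) (y i)).
Definition ydist l (m : 'I_l -> nat) (y : forall i : 'I_l, 'cV[R]_(m i))
    (S : set (forall i : 'I_l, 'cV[R]_(m i))) : \bar R :=
  ereal_inf [set (ynorm (fun i => y i - z i))%:E | z in S].

Definition dual_fun l n (m : 'I_l -> nat) (A : forall i : 'I_l, 'M[R]_(m i, n))
    (C : forall i : 'I_l, set 'cV[R]_(m i)) (vbar : 'cV[R]_n)
    (y : forall i : 'I_l, 'cV[R]_(m i)) : \bar R :=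
  ((2^-1 * enorm (\sum_(i < l) (A i)^T *m y i - vbar) ^+ 2
    - 2^-1 * enorm vbar ^+ 2)%:E + \sum_(i < l) supp_fun (C i) (y i))%E.

End Defs.

(* Main.v *)
(** Write [T] for the stacked map [y |-> \sum_i A_i^T y_i]. The algorithm is block coordinate proximal
    gradient on [d]: with [s_t = |y^{t+1} - y^t|], the gap [D_t = d(y^t) - dstar] drops by at least a
    multiple of [s_t^2], and [y_i^{t+1}] is normal to [C_i] at a point within [O(s_t)] of
    [A_i x^{t+1}], where [x^t = vbar - T y^t]. Weak duality gives [|x^t - xstar|^2 <= 2 D_t], and
    convexity gives [D_{t+1} <= O(s_t) dist (y^{t+1}, Argmin d)].

    The distance to [Argmin d], which is the set of [y] in [N := \prod_i N_{C_i}(A_i xstar)] with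
    [T y = vbar - xstar], is controlled in two steps. Cone reducibility makes the normal cone map Hoelder
    of exponent [alpha] at [A_i xstar], so [y^{t+1}] is close to [N]. By (b) the cone [T N] is the normal
    cone of the feasible set, and by (c) [vbar - xstar] is relatively interior to it, which gives a
    Hoffman bound for the intersection of [N] with [T y = vbar - xstar]. Hence
    [dist (y^{t+1}, Argmin d) <= O((s_t + sqrt D_{t+1})^alpha)], so
    [D_{t+1}^(2 - alpha) <= O(D_t - D_{t+1})], a recursion that yields both rates. *)
Require Import Defs.
From HB Require Import structures.
From mathcomp Require Import all_boot all_order all_algebra.
From mathcomp Require Import all_classical all_reals all_analysis.
From mathcomp Require Import ring lra.
Import Order.TTheory GRing.Theory Num.Theory.
Import numFieldNormedType.Exports.
Local Open Scope classical_set_scope.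
Local Open Scope ring_scope.
Set Implicit Arguments. Unset Strict Implicit. Unset Printing Implicit Defensive.

(** * Euclidean structure of column vectors *)

Section Euclid.
Variable R : realType.
Implicit Types k n : nat.

(** [Argmin d] can be unbounded, and no bound on the dual iterates themselves is established:
    functionals that are constant on the product of the [C_i] and annihilated by [T] can be added
    freely. Compactness arguments and bounds with a factor [enorm y] are therefore applied to a
    representative modulo such functionals ([orth_compl]), and the part split off is finally added
    back to a dual solution.

    The exponent 2 - alpha comes from two regimes. Let g = sqrt D_{t+1}. If g <= s_t, then D_{t+1}
    <= s_t^2. Otherwise D_{t+1} <= O(s_t g^alpha), so g^(2 - alpha) <= O(s_t), and squaring gives
    the recursion. For alpha = 1 it forces geometric decrease. For alpha < 1 it allows every power
    t^(-r) with r (1 - alpha) <= 1, and (1 - theta)/(2 theta - 1) = alpha/(1 - alpha) is such an r.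
    In (i), convergence to a single dual solution comes from summing geometrically small steps. *)

Lemma innerC k (a b : 'cV[R]_k) : inner a b = inner b a.
Proof. by apply: eq_bigr => j _; rewrite mulrC. Qed.

Lemma innerDl k (a b c : 'cV[R]_k) : inner (a + b) c = inner a c + inner b c.
Proof. by rewrite -big_split; apply: eq_bigr => j _; rewrite mxE mulrDl. Qed.

Lemma innerZl k t (a c : 'cV[R]_k) : inner (t *: a) c = t * inner a c.
Proof. by rewrite /inner big_distrr; apply: eq_bigr => j _; rewrite mxE /= mulrA. Qed.

Lemma innerDr k (a b c : 'cV[R]_k) : inner c (a + b) = inner c a + inner c b.
Proof. by rewrite innerC innerDl !(innerC c). Qed.

Lemma innerZr k t (a c : 'cV[R]_k) : inner c (t *: a) = t * inner c a.
Proof. by rewrite innerC innerZl (innerC c). Qed.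

Lemma innerNl k (a c : 'cV[R]_k) : inner (- a) c = - inner a c.
Proof. by rewrite -scaleN1r innerZl mulN1r. Qed.

Lemma innerNr k (a c : 'cV[R]_k) : inner c (- a) = - inner c a.
Proof. by rewrite innerC innerNl (innerC c). Qed.

Lemma innerBl k (a b c : 'cV[R]_k) : inner (a - b) c = inner a c - inner b c.
Proof. by rewrite innerDl innerNl. Qed.

Lemma innerBr k (a b c : 'cV[R]_k) : inner c (a - b) = inner c a - inner c b.
Proof. by rewrite innerDr innerNr. Qed.

Lemma inner0l k (c : 'cV[R]_k) : inner 0 c = 0.
Proof. by rewrite -(scale0r c) innerZl mul0r. Qed.

Lemma inner0r k (c : 'cV[R]_k) : inner c 0 = 0.
Proof. by rewrite innerC inner0l. Qed.

Definition innerE := (innerDl, innerDr, innerNl, innerNr, innerZl, innerZr,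
  inner0l, inner0r).

Lemma inner_sqD k (a b : 'cV[R]_k) :
  inner (a + b) (a + b) = inner a a + 2 * inner a b + inner b b.
Proof. by rewrite innerDl !innerDr (innerC b a); ring. Qed.

Lemma inner_sqB k (a b : 'cV[R]_k) :
  inner (a - b) (a - b) = inner a a - 2 * inner a b + inner b b.
Proof. by rewrite inner_sqD !innerNr innerNl; ring. Qed.

Lemma inner_ge0 k (a : 'cV[R]_k) : 0 <= inner a a.
Proof. by apply: sumr_ge0 => j _; rewrite -expr2 sqr_ge0. Qed.

Lemma inner_eq0 k (a : 'cV[R]_k) : inner a a = 0 -> a = 0.
Proof.
move/eqP; rewrite psumr_eq0 => [/allP h|j _]; last by rewrite -expr2 sqr_ge0.
apply/colP => j; have := h j; rewrite mem_index_enum => /(_ isT) /=.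
by rewrite mulf_eq0 orbb mxE => /eqP.
Qed.

Lemma inner_mulmxl k n (A : 'M[R]_(k, n)) x y :
  inner (A *m x) y = inner x (A^T *m y).
Proof.
rewrite /inner; under eq_bigr do rewrite mxE big_distrl.
rewrite exchange_big; apply: eq_bigr => j _; rewrite mxE big_distrr.
by apply: eq_bigr => i _; rewrite mxE /=; ring.
Qed.

Lemma inner_sumr k (I : finType) (F : I -> 'cV[R]_k) a :
  inner a (\sum_i F i) = \sum_i inner a (F i).
Proof. by apply: (big_morph (inner a)) => [x y|]; rewrite ?innerDr ?inner0r. Qed.

Lemma enorm_ge0 k (a : 'cV[R]_k) : 0 <= enorm a.
Proof. exact: sqrtr_ge0. Qed.
Hint Resolve enorm_ge0 : core.

Lemma enorm_sqr k (a : 'cV[R]_k) : enorm a ^+ 2 = inner a a.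
Proof. by rewrite sqr_sqrtr // inner_ge0. Qed.

Lemma enorm0 k : enorm (0 : 'cV[R]_k) = 0.
Proof. by rewrite /enorm inner0l sqrtr0. Qed.

Lemma enorm_eq0 k (a : 'cV[R]_k) : enorm a = 0 -> a = 0.
Proof. by move=> h; apply: inner_eq0; rewrite -enorm_sqr h expr0n. Qed.

Lemma enormZ k t (a : 'cV[R]_k) : enorm (t *: a) = `|t| * enorm a.
Proof.
by rewrite /enorm innerZl innerZr mulrA -expr2 sqrtrM ?sqr_ge0 // sqrtr_sqr.
Qed.

Lemma enormN k (a : 'cV[R]_k) : enorm (- a) = enorm a.
Proof. by rewrite -scaleN1r enormZ normrN1 mul1r. Qed.

Lemma enormBC k (a b : 'cV[R]_k) : enorm (a - b) = enorm (b - a).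
Proof. by rewrite -enormN opprB. Qed.

Lemma le_enorm_sqr k k' (a : 'cV[R]_k) (b : 'cV[R]_k') :
  (enorm a <= enorm b) = (inner a a <= inner b b).
Proof. by rewrite -!enorm_sqr ler_pXn2r ?nnegrE. Qed.

(** Cauchy-Schwarz, from the nonnegative squared norm of the component of [a] orthogonal to [b]. *)
Lemma inner_le k (a b : 'cV[R]_k) : inner a b <= enorm a * enorm b.
Proof.
have [->|b0] := eqVneq b 0; first by rewrite inner0r enorm0 mulr0.
have bb : 0 < inner b b.
  by rewrite lt_def inner_ge0 andbT; apply: contraNneq b0 => /inner_eq0 ->.
have h := inner_ge0 (a - (inner a b / inner b b) *: b).
apply: le_trans (ler_norm _) _.
rewrite -ler_sqr ?nnegrE ?mulr_ge0 // exprMn real_normK ?num_real // !enorm_sqr.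
have := divfK (lt0r_neq0 bb) (inner a b); move: h.
rewrite !(innerE, innerBl, innerBr) (innerC b a).
by set w := _ / _ => h tE; move: h; rewrite -tE; nra.
Qed.

Lemma inner_abs_le k (a b : 'cV[R]_k) : `|inner a b| <= enorm a * enorm b.
Proof.
by rewrite ler_norml inner_le lerNl -innerNl -(enormN a) inner_le.
Qed.

Lemma enormD k (a b : 'cV[R]_k) : enorm (a + b) <= enorm a + enorm b.
Proof.
rewrite -ler_sqr ?nnegrE ?addr_ge0 // enorm_sqr !innerE (innerC b a).
by rewrite sqrrD !enorm_sqr; have := inner_le a b; lra.
Qed.

Lemma enormB k (a b : 'cV[R]_k) : enorm (a - b) <= enorm a + enorm b.
Proof. by rewrite -(enormN b) enormD. Qed.

Lemma enorm_tri k (a b c : 'cV[R]_k) :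
  enorm (a - c) <= enorm (a - b) + enorm (b - c).
Proof. by have := enormD (a - b) (b - c); rewrite addrA subrK. Qed.

Lemma enorm_sum k (I : finType) (F : I -> 'cV[R]_k) :
  enorm (\sum_i F i) <= \sum_i enorm (F i).
Proof.
elim/big_ind2: _ => [|a x b y xa yb|//]; first by rewrite enorm0.
by apply: le_trans (enormD _ _) _; apply: lerD.
Qed.

Lemma enorm_coord k (a : 'cV[R]_k) j : `|a j ord0| <= enorm a.
Proof.
rewrite -sqrtr_sqr ler_sqrt ?inner_ge0 // /inner (bigD1 j) //= expr2 lerDl.
by apply: sumr_ge0 => i _; rewrite -expr2 sqr_ge0.
Qed.

Lemma col_sum_delta k (a : 'cV[R]_k) : a = \sum_j a j ord0 *: delta_mx j ord0.
Proof.
apply/colP => i; rewrite summxE (bigD1 i) //= !mxE !eqxx mulr1 big1 ?addr0 //.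
by move=> j ji; rewrite !mxE eq_sym (negbTE ji) mulr0.
Qed.

Lemma enorm_le_sum k (a : 'cV[R]_k) : enorm a <= \sum_j `|a j ord0|.
Proof.
rewrite {1}(col_sum_delta a); apply: le_trans (enorm_sum _) _.
apply: ler_sum => j _; rewrite enormZ ler_piMr // /enorm /inner (bigD1 j) //=.
rewrite !mxE !eqxx mulr1 big1 ?addr0 ?sqrtr1 // => i ij.
by rewrite !mxE (negbTE ij) mulr0.
Qed.

Lemma mulmx_bound k n (A : 'M[R]_(k, n)) :
  exists2 K, 0 <= K & forall x, enorm (A *m x) <= K * enorm x.
Proof.
exists (\sum_i \sum_j `|A i j|).
  by apply: sumr_ge0 => i _; apply: sumr_ge0.
move=> x; apply: le_trans (enorm_le_sum _) _; rewrite mulr_suml.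
apply: ler_sum => i _; rewrite mxE mulr_suml.
apply: le_trans (ler_norm_sum _ _ _) _; apply: ler_sum => j _.
by rewrite normrM ler_wpM2l // enorm_coord.
Qed.

(** The topology and differentials on column vectors refer to the maximum norm; this comparison and
    the next one transfer them to [enorm]. *)
Lemma mx_norm_le_enorm k (a : 'cV[R]_k) : `|a| <= enorm a.
Proof.
rewrite [leLHS]/Num.norm /= mx_normrE; apply/bigmax_leP; split => //= -[i j] _ /=.
by rewrite ord1 enorm_coord.
Qed.

Lemma enorm_le_mx_norm k (a : 'cV[R]_k) : enorm a <= k%:R * `|a|.
Proof.
apply: le_trans (enorm_le_sum _) _.
rewrite -[k in k%:R]card_ord mulr_natl -sumr_const; apply: ler_sum => i _.
rewrite [leRHS]/Num.norm /= mx_normrE.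
by apply: (le_bigmax _ (fun x : 'I_k * 'I_1 => `|a x.1 x.2|) (i, ord0)).
Qed.

Lemma closed_enorm k (D : set 'cV[R]_k) x : closed D ->
  (forall e, 0 < e -> exists2 c, D c & enorm (c - x) < e) -> D x.
Proof.
move=> cD h; apply: cD => B /nbhs_ballP[e e0 eB].
have [c Dc cx] := h _ e0; exists c; split=> //; apply: eB.
by rewrite mx_norm_ball /ball_ /= distrC (le_lt_trans (mx_norm_le_enorm _)).
Qed.

(** Bolzano-Weierstrass in cluster point form, so that no subsequence has to be extracted.
    Compactness of a cube is applied to the transposed vectors. *)
Lemma enorm_bounded_cluster k (u : nat -> 'cV[R]_k) M :
  (forall t, enorm (u t) <= M) ->
  exists x, forall e N, 0 < e -> exists2 t, (N <= t)%N & enorm (u t - x) < e.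
Proof.
move=> uM; pose A := [set v : 'rV[R]_k | forall i, v ord0 i \in `[- M, M]].
have cA : compact A.
  apply: (@rV_compact _  _ (fun=> `[(- M), M]%classic)).
  by move=> _; apply: segment_compact.
have := cA ((fun t => (u t)^T) @ \oo) _; case.
  exists 0%N => // t _ i; rewrite mxE.
  by rewrite in_itv /= -ler_norml (le_trans (enorm_coord _ _)).
move=> p [_ pcl]; exists p^T => e N e0.
have k0 : 0 < (k%:R + 1 : R) by rewrite ltr_wpDl.
have e'0 : 0 < e / (k%:R + 1) by rewrite divr_gt0.
have := pcl [set v | exists2 t, (N <= t)%N & v = (u t)^T] (ball p (e / (k%:R + 1))).
case; first by exists N => // t /= Nt; exists t.
  exact: nbhsx_ballx.
move=> _ [[t Nt ->] /=]; rewrite mx_norm_ball /ball_ /= => h.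
exists t => //; apply: le_lt_trans (enorm_le_mx_norm _) _.
have hn : `|u t - p^T| < e / (k%:R + 1).
  have -> : `|u t - p^T| = `|p - (u t)^T|; last by [].
  rewrite distrC /Num.norm /= !mx_normrE.
  rewrite (reindex (fun x : 'I_1 * 'I_k => (x.2, x.1))) /=; last first.
    by exists (fun x => (x.2, x.1)) => -[].
  by apply: eq_bigr => -[i j] _; rewrite !mxE.
apply: (@le_lt_trans _ _ ((k%:R) * (e / (k%:R + 1)))).
  by rewrite ler_wpM2l // ltW.
by rewrite mulrCA gtr_pMr // ltr_pdivrMr // mul1r ltrDl.
Qed.

End Euclid.
#[global] Hint Extern 0 (is_true (0 <= enorm _)) => solve [apply: enorm_ge0] : core.

(** * Projections, normal cones and tangent cones *)

Section ConvexSets.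
Variable R : realType.
Implicit Types k n : nat.

Definition eclosed k (S : set 'cV[R]_k) :=
  forall x, (forall e, 0 < e -> exists2 c, S c & enorm (c - x) < e) -> S x.

Definition econvex k (S : set 'cV[R]_k) :=
  forall x y t, S x -> S y -> 0 <= t <= 1 -> S (t *: x + (1 - t) *: y).

Definition normal_cone k (C : set 'cV[R]_k) (p : 'cV[R]_k) : set 'cV[R]_k :=
  [set y | forall u, C u -> inner y (u - p) <= 0].

(** The closure of the cone generated by [C - x], which for convex [C] is the usual tangent cone. *)
Definition tangent_cone k (C : set 'cV[R]_k) (x : 'cV[R]_k) : set 'cV[R]_k :=
  [set h | forall e, 0 < e -> exists l c, [/\ 0 <= l, C c &
     enorm (l *: (c - x) - h) < e]].

Lemma closed_eclosed k (S : set 'cV[R]_k) : closed S -> eclosed S.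
Proof. by move=> cS x; apply: closed_enorm. Qed.

Lemma convex_set_econvex k (S : set 'cV[R]_k) : convex_set S -> econvex S.
Proof.
move=> cS x y t Sx Sy /andP[t0 t1].
have := cS x y (Itv01 t0 t1); by rewrite !in_setE => /(_ Sx Sy).
Qed.

(** Weierstrass, with lower semicontinuity on [S] as last hypothesis: a cluster point of points
    whose values are within [1/(t+1)] of the infimum is a minimiser. *)
Lemma exists_minimizer k (S : set 'cV[R]_k) (f : 'cV[R]_k -> R) M :
  S !=set0 -> eclosed S -> (forall x, S x -> enorm x <= M) ->
  (forall x, S x -> 0 <= f x) ->
  (forall x e, S x -> 0 < e -> exists2 d, 0 < d &
     forall z, S z -> enorm (z - x) < d -> f x - e < f z) ->
  exists2 x, S x & forall z, S z -> f x <= f z.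
Proof.
move=> [x0 Sx0] cS bS f0 lf.
have hi : has_inf (f @` S).
  by split; [exists (f x0), x0 | exists 0 => _ [x Sx <-]; exact: f0].
have [I IE] : exists I, I = inf (f @` S) by exists (inf (f @` S)).
have hu (t : nat) : exists2 x, S x & f x < I + (t.+1)%:R^-1.
  have t0 : (0 : R) < (t.+1)%:R^-1 by rewrite invr_gt0.
  by have [_ [x Sx <-]] := inf_adherent t0 hi; rewrite -IE; exists x.
pose u t := xget 0 [set x | S x /\ f x < I + (t.+1)%:R^-1].
have uP t : S (u t) /\ f (u t) < I + (t.+1)%:R^-1.
  by rewrite /u; case: xgetP => // h; case: (hu t) => x Sx fx; have [] := h x.
have [x xP] := enorm_bounded_cluster (fun t => bS _ (uP t).1).
have Sx : S x.
  apply: cS => e e0; have [t _ h] := xP e 0%N e0.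
  by exists (u t) => //; exact: (uP t).1.
exists x => // z Sz; apply: (@le_trans _ _ I); last first.
  by rewrite IE; apply: ge_inf; [exact: hi.2 | exists z].
apply/ler_addgt0Pr => e e0.
have e2 : 0 < e / 2 by rewrite divr_gt0.
have [d d0 dP] := lf _ _ Sx e2.
have [N /= NP] : exists N : nat, (N.+1)%:R^-1 < e / 2.
  by have [N _ h] := near_infty_natSinv_lt (PosNum e2); exists N; apply: h => /=.
have [t Nt /(dP _ (uP t).1)] := xP d N d0.
have h2 := (uP t).2.
have : (t.+1)%:R^-1 <= (N.+1)%:R^-1 :> R by rewrite lef_pV2 ?posrE // ler_nat.
move: NP h2; move: (t.+1%:R^-1) (N.+1%:R^-1) => a b; lra.
Qed.

(** Only points no farther from [z] than a fixed [c0] compete, which makes the search set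
    bounded. *)
Lemma is_proj_exists k (C : set 'cV[R]_k) z :
  C !=set0 -> eclosed C -> exists p, is_proj C z p.
Proof.
move=> [c0 Cc0] cC.
pose S := [set u | C u /\ enorm (z - u) <= enorm (z - c0)].
have [|||||p [Cp zp] pm] := @exists_minimizer _ S (fun u => enorm (z - u))
    (enorm z + enorm (z - c0)).
- by exists c0.
- move=> x h; split.
    by apply: cC => e /h [c [Cc _]] ce; exists c.
  apply/ler_addgt0Pr => e /h [c [_ cz]] ce.
  by have := enorm_tri z c x; lra.
- move=> x [_ h]; have := enorm_tri z 0 (z - x).
  rewrite subr0 sub0r enormN subKr; lra.
- by move=> x.
- move=> x e _ e0; exists e => // w _ wx.
  by have := enorm_tri z w x; lra.
exists p; split => // u Cu; have [zu|/ltW zu] := leP (enorm (z - u)) (enorm (z - c0)).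
  exact: pm.
exact: le_trans zp zu.
Qed.

Lemma is_proj_variational k (C : set 'cV[R]_k) z p : econvex C ->
  is_proj C z p -> normal_cone C p (z - p).
Proof.
move=> vC [Cp pm] u Cu; rewrite leNgt; apply/negP => w0.
set w := inner _ _ in w0; pose q := inner (u - p) (u - p).
have q0 : 0 <= q := inner_ge0 _.
(* Moving from [p] towards [u] by [t] changes the squared distance to [z] by -2tw + t^2 q, negative
   for this [t]. *)
have [t [t0 t1 tw]] : exists t, [/\ 0 < t, t <= 1 & t * (1 + q) <= w].
  exists (Num.min 1 (w / (1 + q))); split; last 1 first.
  - by rewrite -ler_pdivlMr ?ge_min ?lexx ?orbT //; lra.
  - by rewrite lt_min ltr01 divr_gt0 //; lra.
  - by rewrite ge_min lexx.
have tI : 0 <= t <= 1 by rewrite ltW.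
have := pm _ (vC _ _ _ Cu Cp tI); rewrite le_enorm_sqr.
have -> : z - (t *: u + (1 - t) *: p) = (z - p) - t *: (u - p).
  by apply/colP => i; rewrite !mxE; ring.
move: w0 q0 tw; rewrite /w /q; move: (z - p) (u - p) => a b w0 q0 tw.
rewrite !(innerE, innerBl, innerBr) (innerC b a); nra.
Qed.

(** Moreau decomposition: 0 and [2 *: p] both lie in the cone, and testing the variational
    inequality there makes the residual orthogonal to [p]. *)
Lemma closed_cone_proj k (K : set 'cV[R]_k) z :
  eclosed K -> econvex K -> K 0 -> (forall l x, 0 <= l -> K x -> K (l *: x)) ->
  exists p, [/\ K p, inner (z - p) p = 0 & forall u, K u -> inner (z - p) u <= 0].
Proof.
move=> cK vK K0 sK.
have [p pP] := is_proj_exists z (ex_intro _ _ K0) cK.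
have h := is_proj_variational vK pP.
have Kp := pP.1.
have hp : inner (z - p) p = 0.
  have := h _ K0; have := h _ (sK 2 _ (ler0n _ _) Kp).
  have -> : 2 *: p - p = p by apply/colP => i; rewrite !mxE; ring.
  rewrite sub0r innerNr.
  lra.
exists p; split => // u /h; rewrite innerBr hp; lra.
Qed.

Lemma conic_comb k (C : set 'cV[R]_k) x a b c1 c2 : econvex C -> C c1 -> C c2 ->
  0 <= a -> 0 <= b -> exists l c, [/\ 0 <= l, C c &
    a *: (c1 - x) + b *: (c2 - x) = l *: (c - x)].
Proof.
move=> vC C1 C2 a0 b0; have [ab|ab] := eqVneq (a + b) 0.
  have -> : a = 0 by lra.
  have -> : b = 0 by lra.
  by exists 0, c1; rewrite !scale0r addr0.
exists (a + b), (a / (a + b) *: c1 + (1 - a / (a + b)) *: c2).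
have ab0 : 0 < a + b by rewrite lt_def ab addr_ge0.
split; [exact: ltW| apply: vC => //|].
  by apply/andP; split; [exact: divr_ge0 (ltW ab0) | rewrite ler_pdivrMr // mul1r lerDl].
apply/colP => i; rewrite !mxE; field; exact: ab.
Qed.

Lemma normal_cone_eclosed k (C : set 'cV[R]_k) p : eclosed (normal_cone C p).
Proof.
move=> y h u Cu; apply/ler_addgt0Pr => e e0; rewrite add0r.
have q0 : 0 < 1 + enorm (u - p) by have := enorm_ge0 (u - p); lra.
have [c cN ce] := h (e / (1 + enorm (u - p))) (divr_gt0 e0 q0).
have := cN _ Cu; have := inner_le (y - c) (u - p); rewrite innerBl (enormBC y).
have : enorm (c - y) * enorm (u - p) <= e.
  move: ce; rewrite ltr_pdivlMr //.
  by have := enorm_ge0 (c - y); nra.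
lra.
Qed.

Lemma normal_coneD k (C : set 'cV[R]_k) p y z :
  normal_cone C p y -> normal_cone C p z -> normal_cone C p (y + z).
Proof. by move=> hy hz u Cu; rewrite innerDl; have := hy _ Cu; have := hz _ Cu; lra. Qed.

Lemma normal_coneZ k (C : set 'cV[R]_k) p y l : 0 <= l ->
  normal_cone C p y -> normal_cone C p (l *: y).
Proof. by move=> l0 hy u Cu; rewrite innerZl mulr_ge0_le0 //; apply: hy. Qed.

Lemma normal_cone0 k (C : set 'cV[R]_k) p : normal_cone C p 0.
Proof. by move=> u _; rewrite inner0l. Qed.

(** Moreau decomposition along the tangent cone: the residual of the projection is polar to it,
    hence normal, since the tangent cone contains [u - p] for every [u] in [C]. *)
Lemma tangent_normal k (C : set 'cV[R]_k) (p : 'cV[R]_k) : C p -> econvex C -> forall z,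
  exists (n h : 'cV[R]_k), [/\ z = n + h, normal_cone C p n, tangent_cone C p h & inner n h = 0].
Proof.
move=> Cp vC z.
have T0 : tangent_cone C p 0.
  by move=> e e0; exists 0, p; rewrite scale0r subr0 enorm0.
have TZ l h : 0 <= l -> tangent_cone C p h -> tangent_cone C p (l *: h).
  move=> l0 hT e e0; have l1 : 0 < 1 + l by lra.
  have [l' [c [l'0 Cc hc]]] := hT (e / (1 + l)) (divr_gt0 e0 l1).
  exists (l * l'), c; split=> //; first exact: mulr_ge0.
  rewrite -scalerA -scalerBr enormZ ger0_norm //.
  move: hc; rewrite ltr_pdivlMr //.
  have := enorm_ge0 (l' *: (c - p) - h); nra.
have TD h1 h2 : tangent_cone C p h1 -> tangent_cone C p h2 -> tangent_cone C p (h1 + h2).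
  move=> H1 H2 e e0; have e2 : 0 < e / 2 by rewrite divr_gt0.
  have [l1 [c1 [l10 C1 h1c]]] := H1 _ e2; have [l2 [c2 [l20 C2 h2c]]] := H2 _ e2.
  have [l [c [l0 Cc E]]] := conic_comb p vC C1 C2 l10 l20.
  exists l, c; split=> //; rewrite -E opprD addrACA.
  by have := enormD (l1 *: (c1 - p) - h1) (l2 *: (c2 - p) - h2); lra.
have Tv : econvex (tangent_cone C p).
  by move=> x y t Tx Ty /andP[t0 t1]; apply: TD; apply: TZ => //; lra.
have Tc : eclosed (tangent_cone C p).
  move=> x h e e0; have e2 : 0 < e / 2 by rewrite divr_gt0.
  have [h' /(_ _ e2) [l [c [l0 Cc hc]]] hh] := h _ e2.
  exists l, c; split=> //.
  by have := enorm_tri (l *: (c - p)) h' x; lra.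
have [h [Th zh hle]] := closed_cone_proj z Tc Tv T0 TZ.
exists (z - h), h; rewrite subrK; split=> // u Cu; apply: hle => e e0.
by exists 1, u; rewrite scale1r subrr enorm0.
Qed.

End ConvexSets.

(** * Normal cones of cone reducible sets *)

Section ConeReducible.
Variable R : realType.
Implicit Types k n p : nat.

Lemma linear_sum_delta k p (f : {linear 'cV[R]_k -> 'cV[R]_p}) x :
  f x = \sum_j x j ord0 *: f (delta_mx j ord0).
Proof.
rewrite {1}(col_sum_delta x) linear_sum; apply: eq_bigr => j _.
by rewrite linearZ.
Qed.

Lemma linear_enorm_bound k p (f : {linear 'cV[R]_k -> 'cV[R]_p}) :
  exists2 K, 0 <= K & forall x, enorm (f x) <= K * enorm x.
Proof.
exists (\sum_j enorm (f (delta_mx j ord0))).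
  by apply: sumr_ge0 => j _.
move=> x; rewrite linear_sum_delta mulr_suml.
apply: le_trans (enorm_sum _) _; apply: ler_sum => j _.
by rewrite enormZ mulrC ler_wpM2l // enorm_coord.
Qed.

(** A bounded right inverse, obtained by fixing a preimage of each basis vector. *)
Lemma linear_onto_bound k p (f : {linear 'cV[R]_k -> 'cV[R]_p}) :
  (forall w, exists h, f h = w) ->
  exists2 K, 0 <= K & forall w, exists2 h, f h = w & enorm h <= K * enorm w.
Proof.
move=> onto; pose g j := xget 0 [set h | f h = delta_mx j ord0].
have gP j : f (g j) = delta_mx j ord0.
  by rewrite /g; case: xgetP => // h; case: (onto (delta_mx j ord0)) => x /h.
exists (\sum_j enorm (g j)); first by apply: sumr_ge0.
move=> w; exists (\sum_j w j ord0 *: g j).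
  rewrite linear_sum [RHS]col_sum_delta; apply: eq_bigr => j _.
  by rewrite linearZ gP.
rewrite mulr_suml; apply: le_trans (enorm_sum _) _; apply: ler_sum => j _.
by rewrite enormZ mulrC ler_wpM2l // enorm_coord.
Qed.

Lemma differentiable_enorm k p (f : 'cV[R]_k -> 'cV[R]_p) x :
  differentiable f x -> forall e, 0 < e -> exists2 d, 0 < d &
    forall h, enorm h < d -> enorm (f (x + h) - f x - 'd f x h) <= e * enorm h.
Proof.
move=> df e e0; have k0 : 0 < p%:R + 1 :> R by rewrite ltr_wpDl.
have /eqaddoP/(_ _ (divr_gt0 e0 k0)) := diff_locally df.
move=> /nbhs_ballP[d /= d0 dP].
exists d => // h hd.
have := dP h; rewrite mx_norm_ball /ball_ /= sub0r normrN.
move=> /(_ (le_lt_trans (mx_norm_le_enorm _) hd)).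
have -> : (f \o +%R^~ x - (cst (f x) + 'd f x)) h = f (x + h) - f x - 'd f x h.
  by rewrite -[LHS]/(f (h + x) - (f x + 'd f x h)) [h + x]addrC opprD addrA.
set w := _ - 'd f x h => wh; apply: le_trans (enorm_le_mx_norm _) _.
have h1 := mx_norm_le_enorm h; have := normr_ge0 w => w0.
have p0 : 0 <= p%:R :> R by [].
have h2 : `|w| * (p%:R + 1) <= e * `|h|.
  by move: wh; rewrite mulrAC ler_pdivlMr.
nra.
Qed.

Lemma dist_lip k (K : set 'cV[R]_k) (P : 'cV[R]_k -> 'cV[R]_k) :
  (forall w, is_proj K w (P w)) ->
  forall w w', enorm (w - P w) <= enorm (w - w') + enorm (w' - P w').
Proof.
move=> PP w w'; apply: le_trans ((PP w).2 _ (PP w').1) _; exact: enorm_tri.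
Qed.

(** Stationarity of the penalty function at a minimiser, in one direction: [b] moves by [s *: g] up
    to a remainder [r] of size o(s), as a differentiable constraint map does. *)
Lemma first_order_penalty k p (a h : 'cV[R]_k) (b g : 'cV[R]_p) (t : R) :
  0 <= t ->
  (forall e, 0 < e -> exists2 d, 0 < d & forall s, 0 < s < d ->
    exists2 r, enorm r <= e * s &
    enorm a ^+ 2 + t * enorm b ^+ 2 <=
    enorm (a + s *: h) ^+ 2 + t * enorm (b + (s *: g + r)) ^+ 2) ->
  0 <= inner a h + t * inner b g.
Proof.
move=> t0 H; rewrite leNgt; apply/negP; set s := _ + _ => s0.
(* If [s] is negative, the cross term with the remainder (through [e]) and the quadratic term
   (through [u] below) each cost at most [- s / 2], which leaves a total of at most 2s - s < 0. *)
have [e [e0 eb]] : exists e, 0 < e /\ 2 * t * enorm b * e <= - s / 2.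
  have d0 : 0 < 4 * t * enorm b + 1 by rewrite ltr_wpDl // !mulr_ge0.
  exists (- s / (4 * t * enorm b + 1)); split.
    by rewrite divr_gt0 // oppr_gt0.
  rewrite mulrA ler_pdivrMr //.
  have : 0 <= - s by lra.
  have := enorm_ge0 b; have : 0 <= t * enorm b by rewrite mulr_ge0.
  nra.
have [d d0 dP] := H _ e0.
pose q := enorm h ^+ 2 + t * (enorm g + e) ^+ 2.
have q0 : 0 <= q by rewrite addr_ge0 ?sqr_ge0 // mulr_ge0 ?sqr_ge0.
have [u [u0 ud uq]] : exists u, [/\ 0 < u, u < d & u * q <= - s / 2].
  have m0 : 0 < Num.min (d / 2) (- s / (2 * (q + 1))).
    by rewrite lt_min !divr_gt0 ?oppr_gt0 //; lra.
  exists (Num.min (d / 2) (- s / (2 * (q + 1)))); split => //.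
    by rewrite gt_min; apply/orP; left; lra.
  apply: (@le_trans _ _ (- s / (2 * (q + 1)) * q)).
    by rewrite ler_wpM2r // ge_min lexx orbT.
  rewrite mulrAC ler_pdivrMr; last lra.
  have : 0 <= - s by lra.
  nra.
have [|r ru] := dP u; first by rewrite u0.
rewrite !enorm_sqr (inner_sqD a) (inner_sqD b) (innerDr (u *: g)) !innerZr innerZl.
have h1 : inner b r <= enorm b * (e * u).
  by apply: le_trans (inner_le _ _) _; rewrite ler_wpM2l.
have h2 : inner (u *: g + r) (u *: g + r) <= (u * (enorm g + e)) ^+ 2.
  rewrite -enorm_sqr ler_sqr ?nnegrE //; last by rewrite mulr_ge0 ?addr_ge0 // ltW.
  apply: le_trans (enormD _ _) _; rewrite enormZ gtr0_norm //; lra.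
move=> h3.
have h4 : t * inner b r <= t * (enorm b * (e * u)) by rewrite ler_wpM2l.
have h5 : t * inner (u *: g + r) (u *: g + r) <= t * (u * (enorm g + e)) ^+ 2.
  by rewrite ler_wpM2l.
have : 0 <= 2 * s + u * q + 2 * t * enorm b * e.
  rewrite -(pmulr_rge0 _ u0) /q enorm_sqr /s; move: h3 h4 h5.
  set x1 := inner a h; set x2 := inner b g; set x3 := inner b r.
  set x4 := inner (_ + r) _; set x5 := enorm b; set x6 := enorm g.
  set x7 := inner h h; lra.
lra.
Qed.

End ConeReducible.

(** * Approximate Lagrange multipliers by penalisation *)

Section Multiplier.
Variable R : realType.
Implicit Types k n p : nat.

(* Penalising the constraint [Xi q \in K] replaces the implicit function theorem: minimisers of
   [|q - q0 - y|^2 + t * dist (Xi q, K)^2] tend to [q0] as [t] grows, and stationarity makes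
   [t (Xi q - proj_K (Xi q))], a vector of the polar cone of [K], an approximate multiplier. *)
Lemma approximate_multiplier k p (C : set 'cV[R]_k) (K : set 'cV[R]_p)
    (Xi : 'cV[R]_k -> 'cV[R]_p) q0 y r :
  0 < r -> C q0 -> normal_cone C q0 y ->
  eclosed K -> econvex K -> K 0 -> (forall l x, 0 <= l -> K x -> K (l *: x)) ->
  (forall x, enorm (x - q0) < r -> differentiable Xi x) ->
  (forall x, enorm (x - q0) < r -> C x <-> K (Xi x)) ->
  forall eta, 0 < eta -> exists q u, [/\ enorm (q - q0) < eta,
    forall w, K w -> inner u w <= 0 &
    forall h, inner y h = inner u ('d Xi q h) + inner (q - q0) h].
Proof.
move=> r0 Cq0 Ny cK vK K0 sK dXi CK eta eta0.
have [e [e0 er ee]] : exists e, [/\ 0 < e, e < r & e <= eta].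
  exists (Num.min (r / 2) eta); split; rewrite ?lt_min ?gt_min ?ge_min ?eta0 ?lexx ?orbT //.
    by rewrite divr_gt0.
  by apply/orP; left; lra.
have [P PP] : exists P, forall w, is_proj K w (P w).
  exists (fun w => xget 0 [set p | is_proj K w p]) => w.
  by case: xgetP => // h; case: (is_proj_exists w (ex_intro _ _ K0) cK) => x /h.
have PK w : K w -> w = P w.
  move=> Kw; apply/eqP; rewrite -subr_eq0; apply/eqP/enorm_eq0/le_anti.
  by rewrite enorm_ge0 andbT; have := (PP w).2 _ Kw; rewrite subrr enorm0.
have contXi x d : enorm (x - q0) < r -> 0 < d -> exists2 d', 0 < d' &
    forall z, enorm (z - x) < d' -> enorm (Xi z - Xi x) < d.
  move=> xr d0; have [d1 d10 d1P] := differentiable_enorm (dXi x xr) ltr01.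
  have [M M0 MP] := linear_enorm_bound ('d Xi x).
  have M2 : 0 < M + 2 by lra.
  exists (Num.min d1 (d / (M + 2))); first by rewrite lt_min d10 divr_gt0.
  move=> z; rewrite lt_min => /andP[/d1P + zd]; rewrite subrKC mul1r => h1.
  have h2 := MP (z - x).
  have := enormD (Xi z - Xi x - 'd Xi x (z - x)) ('d Xi x (z - x)); rewrite subrK.
  have h3 : enorm (z - x) * (M + 2) < d by rewrite -ltr_pdivlMr.
  have := enorm_ge0 (z - x); nra.
pose S := [set x | enorm (x - q0) <= e].
pose F t x := enorm (x - q0 - y) ^+ 2 + t * enorm (Xi x - P (Xi x)) ^+ 2.
have S0 : S q0 by rewrite /S /= subrr enorm0 ltW.
have Sc : eclosed S.
  move=> x h; apply/ler_addgt0Pr => d /h [c Sc cx].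
  by move: Sc; rewrite /S /= => Sc; have := enorm_tri x c q0; rewrite (enormBC x c); lra.
have Fmin (t : R) : 0 <= t -> exists2 x, S x & forall z, S z -> F t x <= F t z.
  move=> t0; apply: (@exists_minimizer _ _ _ _ (enorm q0 + e)); rewrite /F.
  - by exists q0.
  - exact: Sc.
  - by move=> x; rewrite /S /= => h; have := enormD (x - q0) q0; rewrite subrK; lra.
  - by move=> x _; rewrite addr_ge0 ?mulr_ge0 ?sqr_ge0.
  move=> x d Sx d0; set a := enorm (x - q0 - y); set b := enorm (Xi x - P (Xi x)).
  have w0 : 0 < 1 + 2 * a + 2 * (t * b).
    have a0 : 0 <= a := enorm_ge0 _; have : 0 <= t * b := mulr_ge0 t0 (enorm_ge0 _).
    by move: a0; lra.
  pose dd := d / (1 + 2 * a + 2 * (t * b)).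
  have dd0 : 0 < dd by rewrite divr_gt0.
  (* Lowering [a] and [b] by at most [dd] lowers [F t x] by at most [2 * a * dd + 2 * (t * b) * dd],
     which is less than [d]. *)
  have ddE : dd * (1 + 2 * a + 2 * (t * b)) = d by rewrite divfK // gt_eqF.
  have [d1 d10 d1P] := contXi x dd (le_lt_trans Sx er) dd0.
  exists (Num.min d1 dd); first by rewrite lt_min d10.
  move=> z _; rewrite lt_min => /andP[/d1P Xz zx].
  have ha : a <= enorm (z - q0 - y) + dd.
    have := enorm_tri (x - q0 - y) (z - q0 - y) 0; rewrite !subr0 -/a.
    have -> : x - q0 - y - (z - q0 - y) = - (z - x).
      by apply/colP => i; rewrite !mxE; ring.
    by rewrite enormN; lra.
  have hb : b <= enorm (Xi z - P (Xi z)) + dd.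
    by have := dist_lip PP (Xi x) (Xi z); rewrite -/b (enormBC (Xi x) (Xi z)); lra.
  have sq (u v w : R) : 0 <= u -> 0 <= v -> u <= v + w -> 0 <= w ->
      u ^+ 2 - 2 * u * w <= v ^+ 2.
    move=> u0 v0 uv w1; have [uw|uw] := leP u w.
      by apply: le_trans (sqr_ge0 v); nra.
    have : (u - w) ^+ 2 <= v ^+ 2 by rewrite ler_sqr ?nnegrE //; lra.
    nra.
  have sa := sq _ _ _ (enorm_ge0 _) (enorm_ge0 _) ha (ltW dd0).
  have sb := ler_wpM2l t0 (sq _ _ _ (enorm_ge0 _) (enorm_ge0 _) hb (ltW dd0)).
  move: sa sb; rewrite -/a -/b => sa sb.
  have ddd : d = dd + 2 * a * dd + 2 * (t * b) * dd by rewrite -ddE; ring.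
  lra.
pose Q t := xget 0 [set x | S x /\ forall z, S z -> F t x <= F t z].
have QP t : 0 <= t -> S (Q t) /\ forall z, S z -> F t (Q t) <= F t z.
  move=> t0; rewrite /Q; case: xgetP => // h.
  by have [x Sx xm] := Fmin t t0; case: (h x).
have F0 t : F t q0 = enorm y ^+ 2.
  rewrite /F subrr sub0r enormN -(PK (Xi q0)) ?subrr ?enorm0 ?expr0n /= ?mulr0 ?addr0 //.
  by apply/CK => //; rewrite subrr enorm0.
have [qb qbP] : exists x, forall e N, 0 < e ->
    exists2 t, (N <= t)%N & enorm (Q (t.+1)%:R - x) < e.
  apply: (@enorm_bounded_cluster _ _ (fun t => Q (t.+1)%:R) (enorm q0 + e)) => t.
  have [+ _] := QP (t.+1)%:R (ler0n _ _); rewrite /S /= => h.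
  by have := enormD (Q t.+1%:R - q0) q0; rewrite subrK; lra.
have Sqb : S qb.
  apply: Sc => d d0; have [t _ h] := qbP d 0%N d0.
  by exists (Q t.+1%:R) => //; exact: (QP _ (ler0n _ _)).1.
(* Comparison of the minimiser with [q0], where the penalty term vanishes. *)
have Qle (t : nat) : enorm (Q t.+1%:R - q0 - y) <= enorm y /\
    t.+1%:R * enorm (Xi (Q t.+1%:R) - P (Xi (Q t.+1%:R))) ^+ 2 <= enorm y ^+ 2.
  have := (QP _ (ler0n _ t.+1)).2 _ S0; rewrite F0 /F => h; split.
    rewrite -ler_sqr ?nnegrE //; apply: le_trans h; rewrite lerDl.
    by rewrite mulr_ge0 ?sqr_ge0.
  by apply: le_trans h; rewrite lerDr sqr_ge0.
have qby : enorm (qb - q0 - y) <= enorm y.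
  apply/ler_addgt0Pr => d d0; have [t _ h] := qbP d 0%N d0.
  have := enorm_tri (qb - q0 - y) (Q t.+1%:R - q0 - y) 0; rewrite !subr0.
  have -> : qb - q0 - y - (Q t.+1%:R - q0 - y) = - (Q t.+1%:R - qb).
    by apply/colP => i; rewrite !mxE; ring.
  by rewrite enormN; have := (Qle t).1; lra.
(* By [Qle] the distance from [Xi (Q t.+1%:R)] to [K] is at most [enorm y] over the square root of
   [t.+1]. *)
have KXqb : K (Xi qb).
  suff -> : Xi qb = P (Xi qb) by exact: (PP _).1.
  apply/eqP; rewrite -subr_eq0; apply/eqP/enorm_eq0/le_anti.
  rewrite enorm_ge0 andbT; apply/ler_addgt0Pr => d d0; rewrite add0r.
  have d2 : 0 < d / 2 by rewrite divr_gt0.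
  have [d1 d10 d1P] := contXi qb (d / 2) (le_lt_trans Sqb er) d2.
  have [N NP] : exists N : nat, enorm y ^+ 2 / (d / 2) ^+ 2 < N%:R.
    by exists (Num.bound (enorm y ^+ 2 / (d / 2) ^+ 2)); apply: archi_boundP;
       rewrite divr_ge0 ?sqr_ge0.
  have [t Nt /d1P Xt] := qbP d1 N d10.
  have := dist_lip PP (Xi qb) (Xi (Q t.+1%:R)); rewrite (enormBC (Xi qb) (Xi (Q _))).
  suff : enorm (Xi (Q t.+1%:R) - P (Xi (Q t.+1%:R))) <= d / 2 by lra.
  rewrite -ler_sqr ?nnegrE //; last exact: ltW.
  apply: ltW.
  rewrite -(@ltr_pM2l _ t.+1%:R) //; apply: le_lt_trans (Qle t).2 _.
  rewrite -ltr_pdivrMr ?exprn_gt0 //; apply: lt_le_trans NP _.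
  by rewrite ler_nat (leq_trans Nt).
(* From |qb - q0 - y| <= |y| follows |qb - q0|^2 <= 2 <y, qb - q0>, and this is at most 0 because
   [y] is normal at [q0] and [qb] lies in [C]. *)
have qbE : qb = q0.
  apply/eqP; rewrite -subr_eq0; apply/eqP/inner_eq0/le_anti; rewrite inner_ge0 andbT.
  have Cqb : C qb by apply/CK => //; exact: le_lt_trans Sqb er.
  move: qby (Ny _ Cqb); rewrite le_enorm_sqr inner_sqB (innerC _ y); lra.
have [t _] := qbP e 0%N e0; rewrite qbE.
have [_ Qm] := QP t.+1%:R (ler0n _ _); move: Qm; set q := Q _ => Qm qe.
have qr : enorm (q - q0) < r by exact: lt_trans qe er.
(* [q] is strictly inside the ball [S], so every direction is admissible. Keeping the projection
   [P (Xi q)] fixed only increases the distance to [K], which avoids differentiating that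
   distance. *)
have st h : 0 <= inner (q - q0 - y) h + t.+1%:R * inner (Xi q - P (Xi q)) ('d Xi q h).
  apply: first_order_penalty => // d d0.
  have h1 : 0 < 1 + enorm h by rewrite ltr_pwDl.
  have [d1 d10 d1P] := differentiable_enorm (dXi _ qr) (divr_gt0 d0 h1).
  exists (Num.min d1 (e - enorm (q - q0)) / (1 + enorm h)).
    by rewrite divr_gt0 // lt_min d10 subr_gt0.
  move=> s /andP[s0]; rewrite ltr_pdivlMr // lt_min => /andP[sd1 se].
  have sh : enorm (s *: h) = s * enorm h by rewrite enormZ gtr0_norm.
  have shd : enorm (s *: h) < d1 by rewrite sh; nra.
  exists (Xi (q + s *: h) - Xi q - 'd Xi q (s *: h)).
    apply: le_trans (d1P _ shd) _; rewrite sh.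
    rewrite -[X in _ <= X * s](divfK (lt0r_neq0 h1) d).
    have : 0 <= d / (1 + enorm h) * s by rewrite mulr_ge0 ?divr_ge0 ?ltW.
    nra.
  have Sq : S (q + s *: h).
    rewrite /S /= addrAC; apply: le_trans (enormD _ _) _; rewrite sh; nra.
  apply: le_trans (Qm _ Sq) _; rewrite /F.
  have -> : q + s *: h - q0 - y = q - q0 - y + s *: h.
    by apply/colP => i; rewrite !mxE; ring.
  rewrite lerD2l ler_wpM2l // ler_sqr ?nnegrE //.
  apply: le_trans ((PP _).2 _ (PP (Xi q)).1) _; rewrite linearZ.
  set u := Xi (q + _); set v := Xi q; set g := 'd Xi q h.
  suff -> : v - P v + (s *: g + (u - v - s *: g)) = u - P v by [].
  by apply/colP => i; rewrite !mxE; ring.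
exists q, (t.+1%:R *: (Xi q - P (Xi q))); split.
- exact: lt_le_trans qe ee.
- move=> w Kw; rewrite innerZl mulr_ge0_le0 //.
  have nP := is_proj_variational vK (PP (Xi q)).
  (* The sum is the midpoint of the doubled vectors, which lie in the convex cone [K]. *)
  have KD : K (P (Xi q) + w).
    have := vK _ _ (2^-1) (sK 2 _ (ler0n _ _) (PP (Xi q)).1) (sK 2 _ (ler0n _ _) Kw).
    move/(_ ltac:(lra)); congr K; apply/colP => i; rewrite !mxE; lra.
  by have := nP _ KD; rewrite [P _ + w]addrC addrK.
- move=> h; have := st h; have := st (- h); rewrite linearN !innerNr !(innerBl _ y) innerZl.
  lra.
Qed.

End Multiplier.

(** * Hoelder estimate for normal cones at a reducible point *)

Section NormalConeHolder.
Variable R : realType.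
Implicit Types k n p : nat.

(** A normal [y] at [p] is nearly the transposed differential at a nearby [q] applied to some [u] in
    the polar of [K]. The differential at [xb] sends tangent directions of [C] into [K], where [u]
    is nonpositive, so [y] is at most the Hoelder error on tangent directions. The tangent component
    of [y] is thus small, and its normal component is the vector sought. *)
Lemma cone_reducible_normal k (C : set 'cV[R]_k) xb alpha :
  0 < alpha <= 1 -> econvex C -> C xb -> cone_reducible_at alpha C xb ->
  exists c r : R, [/\ 0 < r, 0 <= c & forall (p y : 'cV[R]_k), C p -> enorm (p - xb) < r ->
    normal_cone C p y -> exists2 n, normal_cone C xb n &
    enorm (y - n) <= c * enorm y * powR (enorm (p - xb)) alpha].
Proof.
move=> /andP[a0 a1] vC Cxb [rho [m [K [Xi [rho0 [[cK [vK [K0 [sK _]]]] [Xi0 [dXi]]]]]]]].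
move=> [_ [onto [[L [L0 HL]] CK]]].
move/closed_eclosed: cK => cK; move/convex_set_econvex: vK => vK.
have CKx x : enorm (x - xb) < rho -> C x <-> K (Xi x).
  move=> xr; split => [Cx|Kx].
    by have [] : ([set x | K (Xi x)] `&` eball xb rho) x by rewrite -CK.
  by have [] : (C `&` eball xb rho) x by rewrite CK.
have xb0 : enorm (xb - xb) < rho by rewrite subrr enorm0.
have [J J0 HJ] := linear_onto_bound onto.
have [M M0 HM] := linear_enorm_bound ('d Xi xb).
(* Since [Xi xb = 0], the difference quotients [s^-1 *: Xi (xb + s *: h)] lie in the cone [K], and
   their limit lies there too. *)
have KdC c : C c -> K ('d Xi xb (c - xb)).
  move=> Cc; apply: cK => e e0; have [h hE] : exists h, h = c - xb by exists (c - xb).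
  rewrite -hE.
  have h1 : 0 < 1 + enorm h by rewrite ltr_pwDl.
  have [d d0 dP] := differentiable_enorm (dXi _ xb0) (divr_gt0 e0 h1).
  have [s [s0 s1 sd]] : exists s, [/\ 0 < s, s <= 1 & s * (1 + enorm h) < Num.min d rho].
    have w0 : 0 < Num.min d rho / 2 / (1 + enorm h).
      by rewrite !divr_gt0 // lt_min d0.
    exists (Num.min 1 (Num.min d rho / 2 / (1 + enorm h))); split.
    - by rewrite lt_min ltr01.
    - by rewrite ge_min lexx.
    - apply: (@le_lt_trans _ _ (Num.min d rho / 2)).
        by rewrite -ler_pdivlMr // ge_min lexx orbT.
      have : 0 < Num.min d rho by rewrite lt_min d0.
      lra.
  move: sd; rewrite lt_min => /andP[sd sr].
  have sh : enorm (s *: h) = s * enorm h by rewrite enormZ gtr0_norm.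
  have Cs : C (xb + s *: h).
    have := vC _ _ s Cc Cxb; rewrite ltW // s1 => /(_ isT); congr C.
    by rewrite hE; apply/colP => i; rewrite !mxE; ring.
  have KXs : K (Xi (xb + s *: h)).
    by apply/CKx => //; rewrite addrAC subrr add0r sh; nra.
  exists (s^-1 *: Xi (xb + s *: h)); first by apply: sK => //; rewrite invr_ge0 ltW.
  have -> : s^-1 *: Xi (xb + s *: h) - 'd Xi xb h =
      s^-1 *: (Xi (xb + s *: h) - Xi xb - 'd Xi xb (s *: h)).
    by rewrite Xi0 subr0 linearZ scalerBr scalerA mulVf ?scale1r // gt_eqF.
  rewrite enormZ gtr0_norm ?invr_gt0 // mulrC ltr_pdivrMr //.
  have shd : enorm (s *: h) < d by rewrite sh; nra.
  apply: le_lt_trans (dP _ shd) _; rewrite sh mulrCA mulrC ltr_pM2r //.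
  by rewrite mulrAC ltr_pdivrMr // ltr_pM2l // ltrDr.
have KdT h : tangent_cone C xb h -> K ('d Xi xb h).
  move=> Th; apply: cK => e e0.
  have M1 : 0 < M + 1 by lra.
  have [l [c [l0 Cc lc]]] := Th _ (divr_gt0 e0 M1).
  exists ('d Xi xb (l *: (c - xb))); first by rewrite linearZ; apply/sK/KdC.
  rewrite -linearB; apply: le_lt_trans (HM _) _.
  move: lc; rewrite ltr_pdivlMr //; have := enorm_ge0 (l *: (c - xb) - h); nra.
have LJ0 : 0 < 2 * (L * J + 1) by rewrite mulr_gt0 // ltr_wpDl ?mulr_ge0.
(* Within [r'] of [xb] the differential changes by so little that [J] times the change is at most
   1/2; surjectivity at [xb] then still controls the multiplier at [q]. *)
have [r' [r'0 r'E]] : exists r', 0 < r' /\ powR r' alpha = (2 * (L * J + 1))^-1.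
  exists (powR (2 * (L * J + 1))^-1 alpha^-1); split.
    by rewrite powR_gt0 // invr_gt0.
  by rewrite -powRrM mulVf ?gt_eqF // powRr1 // invr_ge0 ltW.
(* The constant is (4 J)(2 L) from the change of the differential plus 1 from [q - p]; the radius is
   halved because [q] may be twice as far from [xb] as [p]. *)
exists (8 * J * L + 1), (Num.min rho r' / 2); split.
- by rewrite divr_gt0 // lt_min rho0.
- by rewrite addr_ge0 // !mulr_ge0.
move=> p y Cp pr Np.
have /andP[prho pr'] : (2 * enorm (p - xb) < rho) && (2 * enorm (p - xb) < r').
  by rewrite -lt_min; move: pr; lra.
have [pxb|pxb] := eqVneq p xb.
  exists y; first by rewrite -pxb.
  by rewrite subrr enorm0 mulr_ge0 ?powR_ge0 // mulr_ge0 // addr_ge0 // !mulr_ge0.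
have [y0|yn0] := eqVneq y 0.
  exists 0; first exact: normal_cone0.
  by rewrite y0 subrr enorm0 mulr0 mul0r.
have P0 : 0 < enorm (p - xb).
  by rewrite lt_def enorm_ge0 andbT; apply: contra_neq pxb => /enorm_eq0/subr0_eq.
have Y0 : 0 < enorm y.
  by rewrite lt_def enorm_ge0 andbT; apply: contra_neq yn0 => /enorm_eq0.
set P := enorm (p - xb) in P0 *; set Y := enorm y in Y0 *.
have PA0 : 0 < powR P alpha by rewrite powR_gt0.
have [eta [eta0 etaP etaY etaYP]] :
    exists eta, [/\ 0 < eta, eta <= P, eta <= Y & eta <= Y * powR P alpha].
  exists (Num.min P (Num.min Y (Y * powR P alpha))).
  by rewrite !lt_min P0 Y0 mulr_gt0 // !ge_min !lexx !orbT.
have rp0 : 0 < rho - P by move: prho; rewrite -/P; lra.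
have inr x : enorm (x - p) < rho - P -> enorm (x - xb) < rho.
  by move=> xp; have := enorm_tri x p xb; rewrite -/P; lra.
have [q [u [qp uK st]]] := approximate_multiplier rp0 Cp Np cK vK K0 sK
  (fun x xp => dXi x (inr x xp)) (fun x xp => CKx x (inr x xp)) eta0.
have qxb : enorm (q - xb) <= 2 * P.
  by have := enorm_tri q p xb; rewrite -/P; lra.
have qrho : enorm (q - xb) < rho by move: prho; rewrite -/P; lra.
have dqh h : enorm ('d Xi q h - 'd Xi xb h) <= L * powR (enorm (q - xb)) alpha * enorm h.
  exact: HL.
have qa1 : powR (enorm (q - xb)) alpha <= (2 * (L * J + 1))^-1.
  rewrite -r'E; apply: ge0_ler_powR; rewrite ?nnegrE ?(ltW a0) ?(ltW r'0) //.
  by move: pr'; rewrite -/P; lra.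
have qa2 : powR (enorm (q - xb)) alpha <= 2 * powR P alpha.
  apply: (@le_trans _ _ (powR (2 * P) alpha)).
    apply: ge0_ler_powR; rewrite ?nnegrE ?(ltW a0) //.
    by rewrite mulr_ge0 // ltW.
  rewrite powRM ?(ltW P0) // ler_pM2r //.
  have two1 : (1 : R) <= 2 by rewrite ler1n.
  exact: (@ler1_powR _ 2 alpha two1 a1).
have qa0 : 0 <= powR (enorm (q - xb)) alpha by rewrite powR_ge0.
set qa := powR _ _ in qa0 qa1 qa2 dqh.
move: st dqh; move: ('d Xi q) => Dq st dqh.
move: HJ KdT dqh; move: ('d Xi xb) => Db HJ KdT dqh.
(* Test stationarity at a preimage [g] of [u] under the differential at [xb]; the term with
   [Dq g - Db g] costs at most half of |u|^2 and is absorbed. *)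
have uY : enorm u <= 4 * J * Y.
  have [g gE gle] := HJ u.
  have hu := st g.
  have e1 : inner u u = inner y g - inner (q - p) g - inner u (Dq g - Db g).
    rewrite hu (innerBr (Dq g) (Db g) u) gE.
    by move: (inner u (Dq g)) (inner (q - p) g) => i j; ring.
  have b1 := inner_le y g; have b2 := inner_abs_le (q - p) g.
  have b3 := inner_abs_le u (Dq g - Db g).
  have b4 := dqh g; have U0 := enorm_ge0 u.
  have G0 := enorm_ge0 g.
  have b5 : L * qa * enorm g <= enorm u / 2.
    apply: (@le_trans _ _ (L * (2 * (L * J + 1))^-1 * (J * enorm u))).
      by apply: ler_pM; rewrite ?mulr_ge0 // ler_wpM2l.
    rewrite -mulrA mulrCA ler_pdivrMl // mulrA.
    by move: LJ0; nra.
  have b6 : inner y g <= Y * (J * enorm u).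
    by apply: le_trans b1 _; rewrite ler_wpM2l // ltW.
  have b7 : `|inner (q - p) g| <= Y * (J * enorm u).
    apply: le_trans b2 _; apply: ler_pM => //.
    by apply: ltW; apply: lt_le_trans qp _.
  have b8 : `|inner u (Dq g - Db g)| <= enorm u * (enorm u / 2).
    by apply: le_trans b3 _; rewrite ler_wpM2l // (le_trans b4).
  have e2 := enorm_sqr u.
  move: b7 b8; rewrite !ler_norml => /andP[b7 _] /andP[b8 _].
  have : enorm u ^+ 2 <= (4 * J * Y) * enorm u.
    rewrite e2 e1; lra.
  have [->|un0] := eqVneq (enorm u) 0; first by rewrite !mulr_ge0 // ltW.
  by rewrite expr2 ler_pM2r ?lt_def ?un0 /=.
have yh h : tangent_cone C xb h ->
    inner y h <= (8 * J * L + 1) * Y * powR P alpha * enorm h.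
  move=> /KdT/uK h1; rewrite st.
  have -> : Dq h = Db h + (Dq h - Db h) by rewrite subrKC.
  rewrite innerDr.
  have h2 : inner u (Dq h - Db h) <= 4 * J * Y * (L * (2 * powR P alpha) * enorm h).
    apply: le_trans (inner_le _ _) _; apply: ler_pM => //.
    apply: le_trans (dqh _) _; rewrite ler_wpM2r // ler_wpM2l //.
  have h3 : inner (q - p) h <= Y * powR P alpha * enorm h.
    apply: le_trans (inner_le _ _) _; apply: ler_pM => //.
    by apply: ltW; apply: lt_le_trans qp _.
  lra.
(* Orthogonality gives |y - n|^2 = |h|^2 = <y, h>, to which [yh] applies. *)
have [n [h [yE Nn Th nh]]] := tangent_normal Cxb vC y.
exists n => //; rewrite {1}yE addrAC subrr add0r.
have := yh _ Th; rewrite {1}yE innerDl nh add0r -enorm_sqr.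
have [->|hn0] := eqVneq (enorm h) 0.
  by move=> _; rewrite !mulr_ge0 ?powR_ge0 ?addr_ge0 // ?mulr_ge0 // ltW.
by rewrite expr2 ler_pM2r ?lt_def ?hn0 /=.
Qed.

End NormalConeHolder.

(** * Linear images of normal cones *)

Section LinearRegularity.
Variable R : realType.
Implicit Types k n p : nat.

Lemma enorm_col_mx k p (a : 'cV[R]_k) (b : 'cV[R]_p) :
  enorm (col_mx a b) <= enorm a + enorm b.
Proof.
rewrite -ler_sqr ?nnegrE ?addr_ge0 // enorm_sqr /inner big_split_ord /=.
under eq_bigr do rewrite !col_mxEu.
under [X in _ + X]eq_bigr do rewrite !col_mxEd.
rewrite sqrrD !enorm_sqr /inner.
have : 0 <= enorm a * enorm b by rewrite mulr_ge0.
lra.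
Qed.

(** A family of elements of [S] of maximal rank spans [S], since adjoining a missing element would
    raise the rank. It supplies finitely many directions over which constants can be summed. *)
Lemma spanning_rows k (S : set 'cV[R]_k) : S 0 ->
  exists q (B : 'M[R]_(q, k)), (forall j, S (row j B)^T) /\
    forall s, S s -> (s^T <= B)%MS.
Proof.
move=> S0.
pose P r := `[< exists q (B : 'M[R]_(q, k)), (forall j, S (row j B)^T) /\ \rank B = r >].
have exP : exists r, P r.
  exists 0%N; apply/asboolP; exists 0%N, 0; split; last exact: mxrank0.
  by move=> [].
have bP r : P r -> (r <= k)%N by move=> /asboolP[q [B [_ <-]]]; exact: rank_leq_col.
case: (ex_maxnP exP bP) => r /asboolP[q [B [BS rB]]] rmax.
exists q, B; split=> // s Ss; apply/negPn/negP => sB.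
have /rank_ltmx : (B < col_mx B s^T)%MS.
  rewrite /ltmx col_mx_sub submx_refl /= -addsmxE addsmxSl /=.
  exact: sB.
rewrite rB ltnNge => /negP; apply; apply: rmax; apply/asboolP.
exists (q + 1)%N, (col_mx B s^T); split=> // j; rewrite -(splitK j).
by case: (fintype.split j) => i /=; rewrite ?rowKu ?rowKd // ord1 row_id trmxK.
Qed.

(** For [a] in [C], these are the functionals constant on [C]; adding one preserves normality at any
    point of [C]. *)
Definition orth_compl k (C : set 'cV[R]_k) (a : 'cV[R]_k) : set 'cV[R]_k :=
  [set v | forall u, C u -> inner v (u - a) = 0].

(* Relative interior, with the affine hull replaced by the double orthogonal complement; this
   form is stable under Cartesian products. *)
Definition relint k (C : set 'cV[R]_k) (a : 'cV[R]_k) : Prop :=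
  C a /\ exists2 e, 0 < e & forall d, enorm d < e ->
    (forall v, orth_compl C a v -> inner v d = 0) -> C (a + d).

Lemma ri_relint k (C : set 'cV[R]_k) a : ri C a -> relint C a.
Proof.
move=> [Ca [e [e0 eC]]]; split=> //; exists e => // d de dC.
have [|q [B [BS sB]]] := @spanning_rows _ [set s | C (a + s)] _.
  by rewrite /= addr0.
apply: eC; split; first by rewrite /eball /= addrAC subrr add0r.
(* The columns of the cokernel of [B] are orthogonal to [C - a], hence to [d], so [d] is in the span
   of the rows. *)
have /submxP[D dE] : (d^T <= B)%MS.
  rewrite submxE; apply/eqP/rowP => j; rewrite mxE [RHS]mxE.
  pose v := col j (cokermx B).
  have <- : inner v d = \sum_i d^T 0 i * cokermx B i j.
    by apply: eq_bigr => i _; rewrite !mxE mulrC ord1.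
  apply: dC => u Cu.
  have /submxP[E uE] : ((u - a)^T <= B)%MS by apply: sB; rewrite /= subrKC.
  rewrite -(trmxK (u - a)) uE trmx_mul /v colE.
  rewrite innerC inner_mulmxl trmxK mulmxA mulmx_coker mul0mx inner0r //.
(* Index 0 carries [a] with the complementary weight, the others the points [a + (row i B)^T]. *)
exists q.+1, (fun j => oapp (fun i => a + (row i B)^T) a (unlift ord0 j)),
  (fun j => oapp (fun i => D 0 i) (1 - \sum_i D 0 i) (unlift ord0 j)).
split; last split.
- by move=> j; case: (unliftP ord0 j) => [i|] _ //=; exact: BS.
- rewrite big_ord_recl unlift_none /= [X in _ + X](eq_bigr (fun i => D 0 i)) ?subrK //.
  by move=> i _; rewrite liftK.
rewrite big_ord_recl unlift_none /=.
rewrite [X in _ = _ + X](eq_bigr (fun i => D 0 i *: a + D 0 i *: (row i B)^T)); last first.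
  by move=> i _; rewrite liftK /= scalerDr.
rewrite big_split /= -scaler_suml addrA -scalerDl subrK scale1r; congr (_ + _).
apply: trmx_inj; rewrite dE mulmx_sum_row linear_sum; apply: eq_bigr => i _.
by rewrite linearZ /= trmxK.
Qed.

(** Prolonging segments beyond [a] is what later turns one-sided information over [C] into two-sided
    bounds. *)
Lemma relint_extend k (C : set 'cV[R]_k) a c : relint C a -> C c ->
  exists2 e, 0 < e & C (a - e *: (c - a)).
Proof.
move=> [Ca [e e0 eC]] Cc; have h0 : 0 < 1 + enorm (c - a) by rewrite ltr_pwDl.
exists (e / 2 / (1 + enorm (c - a))); first by rewrite !divr_gt0.
apply: eC => [|v vC]; last by rewrite innerNr innerZr vC // mulr0 oppr0.
rewrite enormN enormZ gtr0_norm ?divr_gt0 // mulrAC ltr_pdivrMr //.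
have := enorm_ge0 (c - a); nra.
Qed.

Variables (N n : nat) (C : set 'cV[R]_N) (A : 'M[R]_(N, n)) (z : 'cV[R]_n).
Hypothesis riz : relint C (A *m z).

(* Coercivity of the support function of [C] modulo the directions on which it is linear and
   that [A^T] annihilates. *)
Lemma bounded_representative : exists2 K, 0 <= K & forall y c,
  (forall u, C u -> inner y u <= c) -> exists y', [/\ A^T *m y' = A^T *m y,
    orth_compl C (A *m z) (y - y') & enorm y' <= K * (enorm (A^T *m y) + `|c|)].
Proof.
pose a := A *m z; have ria : relint C a := riz; have Ca := ria.1; rewrite -/a.
have [|q [B [BS sB]]] := @spanning_rows _ [set s | C (a + s)] _.
  by rewrite /= addr0.
have /choice[e eP] j : exists e, 0 < e /\ C (a - e *: (row j B)^T).
  have [e e0] := relint_extend ria (BS j).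
  by rewrite [a + _]addrC addrK; exists e.
(* The pseudo-inverse of [G] gives a [y'] with the same [A^T *m y] and [B *m y], of size controlled
   by these data; equality of the latter puts [y - y'] in [orth_compl]. *)
pose G := row_mx A B^T.
have [K K0 KP] := mulmx_bound (pinvmx G)^T.
pose W := \sum_j (1 + (e j)^-1).
have W0 : 0 <= W by apply: sumr_ge0 => j _; rewrite addr_ge0 // invr_ge0 ltW // (eP j).1.
exists (K * (1 + W * (1 + enorm z))).
  by rewrite mulr_ge0 ?addr_ge0 ?mulr_ge0 ?addr_ge0.
move=> y c yc; pose y' := (pinvmx G)^T *m (G^T *m y).
have GyE : G^T *m y' = G^T *m y.
  apply: trmx_inj; rewrite !trmx_mul !trmxK -!mulmxA.
  have := @mulmxKpV _ _ _ _ (y^T *m G) G (submxMl _ _).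
  by rewrite -!mulmxA.
have AyE : A^T *m y' = A^T *m y.
  by move: GyE; rewrite /G tr_row_mx !mul_col_mx => /eq_col_mx[].
have ByE : B *m y' = B *m y.
  by move: GyE; rewrite /G tr_row_mx !mul_col_mx trmxK => /eq_col_mx[].
exists y'; split => //.
  move=> u Cu; have /submxP[E uE] : ((u - a)^T <= B)%MS by apply: sB; rewrite /= subrKC.
  rewrite -(trmxK (u - a)) uE trmx_mul innerC inner_mulmxl trmxK mulmxBr ByE subrr.
  by rewrite inner0r.
apply: le_trans (KP _) _; rewrite -mulrA ler_wpM2l //.
rewrite /G tr_row_mx mul_col_mx trmxK; apply: le_trans (enorm_col_mx _ _) _.
have D0 : inner y a <= enorm (A^T *m y) * enorm z.
  by rewrite /a innerC inner_mulmxl innerC inner_le.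
have D0' : - inner y a <= enorm (A^T *m y) * enorm z.
  by rewrite /a innerC inner_mulmxl -innerNl innerC -(enormN z) inner_le.
(* Each coordinate of [B *m y] is bounded above by testing [y] at [a + (row j B)^T] and below by
   testing it at the prolonged point [a - e j *: (row j B)^T]. *)
suff : enorm (B *m y) <= W * ((1 + enorm z) * (enorm (A^T *m y) + `|c|)).
  have := normr_ge0 c; lra.
apply: le_trans (enorm_le_sum _) _; rewrite mulr_suml; apply: ler_sum => j _.
have -> : (B *m y) j ord0 = inner y (row j B)^T.
  by rewrite mxE; apply: eq_bigr => i _; rewrite !mxE mulrC.
have [e0 /yc] := eP j; have := yc _ (BS j); rewrite innerBr innerDr innerZr => h1 h2.
set D := _ * (_ + _); have hD : c - inner y a <= D.
  have := ler_norm c; have := mulr_ge0 (enorm_ge0 z) (normr_ge0 c).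
  rewrite /D; have := enorm_ge0 (A^T *m y); lra.
have hD0 : 0 <= D by rewrite mulr_ge0 ?addr_ge0.
have hi : 0 < (e j)^-1 by rewrite invr_gt0.
have h3 : - inner y (row j B)^T <= (e j)^-1 * D.
  by rewrite ler_pdivlMl //; lra.
have h4 : 0 <= (e j)^-1 * D by rewrite mulr_ge0 // ltW.
by rewrite ler_norml; apply/andP; split; lra.
Qed.

Hypothesis vC : econvex C.
Variable xs : 'cV[R]_n.
Hypothesis Cxs : C (A *m xs).

Definition preimage_normal : set 'cV[R]_n :=
  [set g | forall w, C (A *m w) -> inner g (w - xs) <= 0].

Lemma orth_compl_normal y y' : normal_cone C (A *m xs) y ->
  orth_compl C (A *m z) y' -> normal_cone C (A *m xs) (y + y').
Proof.
move=> Ny oy u Cu; have := Ny _ Cu; have := oy _ Cu; have := oy _ Cxs.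
rewrite !innerBr !innerDl; lra.
Qed.

Lemma orth_complN y : orth_compl C (A *m z) y -> orth_compl C (A *m z) (- y).
Proof. by move=> oy u Cu; rewrite innerNl oy // oppr0. Qed.

(** A linear image of a closed cone need not be closed; here preimages can be replaced by bounded
    ones with the same image, and a cluster point of these finishes. *)
Lemma image_normal_closed : eclosed [set A^T *m y | y in normal_cone C (A *m xs)].
Proof.
have [K K0 KP] := bounded_representative.
have [M M0 MP] := mulmx_bound A^T.
move=> g gP.
have {}gP (t : nat) : exists y, [/\ normal_cone C (A *m xs) y,
    enorm (A^T *m y - g) < t.+1%:R^-1 &
    enorm y <= K * ((enorm g + 1) * (1 + enorm xs))].
  have t0 : (0 : R) < (t.+1)%:R^-1 by rewrite invr_gt0.
  have [_ [y Ny <-] yg] := gP _ t0.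
  have t1 : t.+1%:R^-1 <= 1 :> R by rewrite invf_le1 // ler1n.
  (* A vector normal at [A *m xs] has its supremum over [C] there, and this value is
     [inner (A^T *m y) xs]. *)
  have [|y' [yE oy ye]] := KP y (inner (A^T *m y) xs).
    by move=> u /Ny; rewrite innerBr (innerC _ xs) -inner_mulmxl (innerC _ y); lra.
  exists y'; split.
  - by have := orth_compl_normal Ny (orth_complN oy); rewrite subKr.
  - by rewrite yE.
  apply: le_trans ye _; rewrite ler_wpM2l //.
  have h1 : enorm (A^T *m y) <= enorm g + 1.
    have := enormD (A^T *m y - g) g; rewrite subrK.
    by have := lt_le_trans yg t1; lra.
  have := inner_abs_le (A^T *m y) xs.
  have := enorm_ge0 xs; nra.
pose u t := xget 0 [set y | [/\ normal_cone C (A *m xs) y,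
    enorm (A^T *m y - g) < t.+1%:R^-1 &
    enorm y <= K * ((enorm g + 1) * (1 + enorm xs))]].
have uP t : [/\ normal_cone C (A *m xs) (u t),
    enorm (A^T *m u t - g) < t.+1%:R^-1 &
    enorm (u t) <= K * ((enorm g + 1) * (1 + enorm xs))].
  by rewrite /u; case: xgetP => // h; case: (gP t) => y /h.
have [y yP] := enorm_bounded_cluster (fun t => let: And3 _ _ h := uP t in h).
exists y.
  apply: normal_cone_eclosed => e e0; have [t _ h] := yP e 0%N e0.
  by exists (u t) => //; case: (uP t).
apply/eqP; rewrite -subr_eq0; apply/eqP/enorm_eq0/le_anti; rewrite enorm_ge0 andbT.
apply/ler_addgt0Pr => e e0; rewrite add0r.
have M1 : 0 < M + 1 by lra.
have e2 : 0 < e / 2 by lra.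
have [m /= mP] : exists m : nat, (m.+1)%:R^-1 < e / 2.
  by have [m _ h] := near_infty_natSinv_lt (PosNum e2); exists m; apply: h => /=.
have [t mt] := yP _ m (divr_gt0 e2 M1); rewrite ltr_pdivlMr // => ut.
have [_ ug _] := uP t.
have := enorm_tri (A^T *m y) (A^T *m u t) g; rewrite -mulmxBr.
have := MP (y - u t); rewrite (enormBC y (u t)).
have : (t.+1)%:R^-1 <= (m.+1)%:R^-1 :> R by rewrite lef_pV2 ?posrE // ler_nat.
have := enorm_ge0 (u t - y).
move: ug mP; move: (t.+1%:R^-1) (m.+1%:R^-1) => i j; nra.
Qed.

(** Chain rule for normal cones. Project [g] on the closed cone of images. The residual [w] has
    [A *m w] tangent to [C], and tilting it towards the relative interior makes it a feasible
    direction, so [inner g w <= 0]; but [inner g w] equals |w|^2. *)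
Lemma preimage_normalE g : preimage_normal g <->
  exists2 y, normal_cone C (A *m xs) y & A^T *m y = g.
Proof.
split; last first.
  move=> [y Ny <-] w Cw; rewrite innerC -inner_mulmxl innerC mulmxBr.
  exact: Ny.
move=> Ng.
have [_ [[y Ny <-] hp hle]] : exists p : 'cV[R]_n, [/\ [set A^T *m y | y in normal_cone C (A *m xs)] p,
    inner (g - p) p = 0 & forall u, [set A^T *m y | y in normal_cone C (A *m xs)] u ->
    inner (g - p) u <= 0].
  apply: closed_cone_proj.
  - exact: image_normal_closed.
  - move=> _ _ t [y1 N1 <-] [y2 N2 <-] /andP[t0 t1].
    exists (t *: y1 + (1 - t) *: y2); last by rewrite mulmxDr !scalemxAr.
    by apply: normal_coneD; apply: normal_coneZ => //; lra.
  - by exists 0; [exact: normal_cone0 | rewrite mulmx0].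
  - move=> l _ l0 [y Ny <-]; exists (l *: y); last by rewrite scalemxAr.
    exact: normal_coneZ.
exists y => //.
have [w wE] : exists w, w = g - A^T *m y by exists (g - A^T *m y).
move: hp hle; rewrite -wE => hp hle.
suff : inner g w <= 0.
  have gE : g = w + A^T *m y by rewrite wE subrK.
  rewrite {1}gE innerDl (innerC (A^T *m y)) hp => h.
  apply/eqP; rewrite eq_sym -subr_eq0 -wE; apply/eqP/inner_eq0/le_anti.
  by rewrite inner_ge0; lra.
have hw v : normal_cone C (A *m xs) v -> inner v (A *m w) <= 0.
  by move=> Nv; rewrite innerC inner_mulmxl; apply: hle; exists v.
(* The normal component of [A *m w] pairs nonpositively with [A *m w], so it vanishes. *)
have Tw : tangent_cone C (A *m xs) (A *m w).
  have [n' [h [E Nn Th nh]]] := tangent_normal Cxs vC (A *m w).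
  have : inner n' n' <= 0 by have := hw _ Nn; rewrite E innerDr nh; lra.
  move=> h0; suff n0 : n' = 0 by rewrite E n0 add0r.
  by apply/inner_eq0/le_anti; rewrite h0 inner_ge0.
have [Ca [r r0 rC]] := riz.
have ow v : orth_compl C (A *m z) v -> inner v (A *m w) = 0.
  move=> ov; apply/le_anti/andP; split.
    by apply: hw; rewrite -(add0r v); apply: orth_compl_normal => //; exact: normal_cone0.
  rewrite -oppr_le0 -innerNl; apply: hw.
  rewrite -(add0r (- v)); apply: orth_compl_normal; first exact: normal_cone0.
  exact: orth_complN.
(* The error in approximating [A *m w] by a multiple of [c - A *m xs], divided by [e], is a
   displacement of [A *m z] small enough to stay in [C]. *)
have claim e : 0 < e -> inner g (w + e *: (z - xs)) <= 0.
  move=> e0; have [l [c [l0 Cc lc]]] := Tw _ (mulr_gt0 e0 r0).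
  pose d := e^-1 *: (A *m w - l *: (c - A *m xs)).
  have Cd : C (A *m z + d).
    apply: rC.
      by rewrite /d enormZ gtr0_norm ?invr_gt0 // enormBC ltr_pdivrMl.
    move=> v ov; rewrite innerZr innerBr ow // innerZr.
    have := ov _ Cc; have := ov _ Cxs; rewrite !innerBr => h1 h2.
    have -> : inner v c - inner v (A *m xs) = 0 by lra.
    by rewrite mulr0 subrr mulr0.
  have [L [u [L0 Cu LE]]] := conic_comb (A *m xs) vC Cc Cd l0 (ltW e0).
  have LE' : L *: (u - A *m xs) = A *m (w + e *: (z - xs)).
    rewrite -LE /d mulmxDr -scalemxAr mulmxBr; apply/colP => i; rewrite !mxE; field.
    exact: lt0r_neq0.
  have L1 : 0 < L + 1 by lra.
  have := Ng (xs + (L + 1)^-1 *: (w + e *: (z - xs))).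
  rewrite addrAC subrr add0r innerZr pmulr_rle0 ?invr_gt0 //; apply.
  rewrite mulmxDr -scalemxAr -LE' scalerA.
  have := vC Cu Cxs (t := (L + 1)^-1 * L); move=> H.
  have : 0 <= (L + 1)^-1 * L <= 1.
    by rewrite mulr_ge0 ?invr_ge0 ?(ltW L1) //= ler_pdivrMl // mulr1 lerDl.
  move/H; congr C; apply/colP => i; rewrite !mxE; ring.
apply/ler_addgt0Pr => e e0; rewrite add0r.
have q0 : 0 < 1 + `|inner g (z - xs)| by rewrite ltr_pwDl.
have := claim _ (divr_gt0 e0 q0); rewrite innerDr innerZr.
have : - (e / (1 + `|inner g (z - xs)|) * inner g (z - xs)) <= e.
  rewrite -mulrN mulrAC ler_pdivrMr // ler_pM2l //.
  by have := ler_norm (- inner g (z - xs)); rewrite normrN; lra.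
lra.
Qed.

(* Hoffman-type bound: since [b] is relatively interior to the convex cone [A^T N], the defect
   [b - A^T y] is, up to a multiple of [b], the image of an element of [N] of comparable size. *)
Lemma normal_cone_regular b : relint preimage_normal b ->
  exists2 K, 0 <= K & forall y, normal_cone C (A *m xs) y ->
    exists yb, [/\ normal_cone C (A *m xs) yb, A^T *m yb = b &
      enorm (y - yb) <= K * enorm (A^T *m y - b) * (1 + enorm y)].
Proof.
move=> rib; have S0 : preimage_normal 0 by move=> w _; rewrite inner0l.
have [q [B [BS sB]]] := spanning_rows S0.
have /choice[f fP] j : exists f, normal_cone C (A *m xs) f /\ A^T *m f = (row j B)^T.
  by have /preimage_normalE[f Nf fE] := BS j; exists f.
(* Prolonging beyond [b] realises the opposite of each spanning direction up to a multiple of [b];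
   it serves the negative parts [cm] of the coefficients. *)
have /choice[r rP] j : exists r : R * 'cV[R]_N, [/\ 0 < r.1, normal_cone C (A *m xs) r.2 &
    A^T *m r.2 = b - r.1 *: ((row j B)^T - b)].
  have [e e0 /preimage_normalE[v Nv vE]] := relint_extend rib (BS j).
  by exists (e, v).
have [K K0 KP] := mulmx_bound (pinvmx B)^T.
pose W := \sum_j (enorm (f j) + (r j).1^-1 * enorm (r j).2 + (r j).1^-1 * (1 + (r j).1)).
have W0 : 0 <= W.
  apply: sumr_ge0 => j _; have [e0 _ _] := rP j; have i0 := ltW e0.
  by rewrite !addr_ge0 ?mulr_ge0 ?invr_ge0 ?addr_ge0.
exists (K * W); first by rewrite mulr_ge0.
move=> y Ny; set u := A^T *m y - b.
have uB : ((- u)^T <= B)%MS.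
  rewrite opprB linearB /= addmx_sub ?eqmx_opp //; apply: sB; first exact: rib.1.
  by apply/preimage_normalE; exists y.
pose c := (pinvmx B)^T *m (- u).
have uE : - u = \sum_j c j ord0 *: (row j B)^T.
  apply: trmx_inj; rewrite -[LHS](mulmxKpV uB) mulmx_sum_row linear_sum.
  apply: eq_bigr => j _; rewrite linearZ /= trmxK; congr (_ *: _).
  by rewrite /c -(trmxK (pinvmx B)) -trmx_mul trmxK mxE.
have cle j : `|c j ord0| <= K * enorm u.
  by apply: le_trans (enorm_coord _ _) _; rewrite -(enormN u); exact: KP.
pose cp j := Num.max (c j ord0) 0; pose cm j := Num.max (- c j ord0) 0.
have cp0 j : 0 <= cp j by rewrite /cp le_max lexx orbT.
have cm0 j : 0 <= cm j by rewrite /cm le_max lexx orbT.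
have cpm j : c j ord0 = cp j - cm j.
  by rewrite /cp /cm; have [h|h] := leP (c j ord0) 0; have [h'|h'] := leP (- c j ord0) 0; lra.
have cpl j : cp j <= K * enorm u.
  have := cle j; rewrite ler_norml ge_max => /andP[_ ->] /=.
  by rewrite mulr_ge0.
have cml j : cm j <= K * enorm u.
  have := cle j; rewrite ler_norml ge_max => /andP[h _] /=.
  by rewrite lerNl h mulr_ge0.
pose h := \sum_j (cp j *: f j + (cm j * (r j).1^-1) *: (r j).2).
pose mu := \sum_j cm j * ((r j).1^-1 * (1 + (r j).1)).
have mu0 : 0 <= mu.
  apply: sumr_ge0 => j _; have [e0 _ _] := rP j.
  by rewrite !mulr_ge0 ?invr_ge0 ?addr_ge0 // ltW.
have hE : A^T *m h = - u + mu *: b.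
  rewrite /h mulmx_sumr uE /mu scaler_suml -big_split; apply: eq_bigr => j _ /=.
  have [_ fE] := fP j; have [e0 _ rE] := rP j.
  rewrite mulmxDr -!scalemxAr fE rE cpm; apply/colP => i; rewrite !mxE; field.
  exact: lt0r_neq0.
have Nh : normal_cone C (A *m xs) h.
  apply: (big_ind (normal_cone C (A *m xs))) => [|v w|j _].
  - exact: normal_cone0.
  - exact: normal_coneD.
  have [Nf _] := fP j; have [e0 Nr _] := rP j.
  by apply: normal_coneD; apply: normal_coneZ => //; rewrite mulr_ge0 ?invr_ge0 // ltW.
have m1 : 0 < 1 + mu by lra.
(* Since [A^T *m h = - u + mu *: b], the image of [y + h] is [(1 + mu) *: b], and rescaling gives
   [b] exactly. *)
exists ((1 + mu)^-1 *: (y + h)); split.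
- by apply: normal_coneZ; [rewrite invr_ge0 ltW | apply: normal_coneD].
- rewrite -scalemxAr mulmxDr hE /u.
  have -> : A^T *m y + (- (A^T *m y - b) + mu *: b) = (1 + mu) *: b.
    by apply/colP => i; rewrite !mxE; ring.
  by rewrite scalerA mulVf ?scale1r // lt0r_neq0.
have -> : y - (1 + mu)^-1 *: (y + h) = (1 + mu)^-1 *: (mu *: y - h).
  by apply/colP => i; rewrite !mxE; field; exact: lt0r_neq0.
rewrite enormZ gtr0_norm ?invr_gt0 // ler_pdivrMl //.
apply: (@le_trans _ _ (mu * enorm y + enorm h)).
  by apply: le_trans (enormB _ _) _; rewrite enormZ ger0_norm.
have hle : enorm h <= K * enorm u * W.
  apply: le_trans (enorm_sum _) _; rewrite /W mulr_sumr; apply: ler_sum => j _.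
  have [e0 _ _] := rP j; have i0 : 0 < (r j).1^-1 by rewrite invr_gt0.
  apply: le_trans (enormD _ _) _; rewrite !enormZ !ger0_norm ?mulr_ge0 ?(ltW i0) //.
  rewrite [leRHS]mulrDr [X in _ <= X + _]mulrDr; apply: ler_wpDr.
    by rewrite !mulr_ge0 ?addr_ge0 ?(ltW i0) ?(ltW e0).
  apply: lerD; first by rewrite ler_wpM2r.
  by rewrite -[leLHS]mulrA ler_wpM2r // mulr_ge0 // ltW.
have mle : mu <= K * enorm u * W.
  rewrite /W mulr_sumr; apply: ler_sum => j _.
  have [e0 _ _] := rP j; have i0 : 0 < (r j).1^-1 by rewrite invr_gt0.
  have k0 : 0 <= K * enorm u by rewrite mulr_ge0.
  apply: (@le_trans _ _ (K * enorm u * ((r j).1^-1 * (1 + (r j).1)))).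
    by rewrite ler_wpM2r // mulr_ge0 ?addr_ge0 ?(ltW i0) ?(ltW e0).
  by rewrite ler_wpM2l // lerDr addr_ge0 // mulr_ge0 // ltW.
have X0 : 0 <= K * enorm u * W by rewrite !mulr_ge0.
apply: (@le_trans _ _ (K * W * enorm u * (1 + enorm y))); last first.
  by rewrite ler_peMl ?lerDl // !mulr_ge0 ?addr_ge0.
have := enorm_ge0 y; rewrite mulrAC; nra.
Qed.

End LinearRegularity.

(** * Rates for real sequences *)

Section RealSequences.
Variable R : realType.
Implicit Types (D : nat -> R) (T t : nat).

Lemma nonincreasing_gap D : (forall t, 0 <= D t) -> (forall t, D t.+1 <= D t) ->
  forall e, 0 < e -> exists T, forall t, (T <= t)%N -> D t - D t.+1 < e.
Proof.
move=> D0 dD e e0.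
have hi : has_inf (range D) by split; [exists (D 0%N), 0%N | exists 0 => _ [t _ <-]].
have [_ [T _ <-] hT] := inf_adherent e0 hi.
exists T => t Tt; have h1 : inf (range D) <= D t.+1.
  by apply: ge_inf; [exact: hi.2 | exists t.+1].
have h2 : D t <= D T.
  by rewrite -(subnK Tt); elim: (t - T)%N => // k; apply: le_trans; rewrite addSn.
lra.
Qed.

Lemma linear_rate D T C : 0 < C -> (forall t, 0 <= D t) ->
  (forall t, (T <= t)%N -> D t.+1 <= C * (D t - D t.+1)) ->
  exists2 a, 0 < a & forall t, (T <= t)%N -> D t <= a * (C / (1 + C)) ^+ t.
Proof.
move=> C0 D0 H; set q := C / (1 + C).
have C1 : 0 < 1 + C by lra.
have q0 : 0 < q by rewrite divr_gt0.
exists ((D T + 1) / q ^+ T); first by rewrite divr_gt0 ?exprn_gt0 // ltr_wpDl.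
move=> t Tt; rewrite -(subnK Tt) exprD mulrCA divfK ?gt_eqF ?exprn_gt0 //.
elim: (t - T)%N => [|k IH]; first by rewrite add0n expr0 mul1r lerDl.
rewrite addSn exprS; have := H _ (leq_addl k T).
move=> h; have h1 : D (k + T).+1 <= q * D (k + T)%N.
  by rewrite /q mulrAC ler_pdivlMr //; lra.
apply: le_trans h1 _; rewrite -[leRHS]mulrA ler_wpM2l ?(ltW q0) //.
Qed.

(** (1 + u)^r <= exp(ru) <= 1/(1 - ru) <= 1 + 2ru. *)
Lemma powR_1D_le (u r : R) : 0 < u -> 0 < r -> r * u <= 2^-1 ->
  powR (1 + u) r <= 1 + 2 * (r * u).
Proof.
move=> u0 r0 ru; have u1 : 0 < 1 + u by lra.
rewrite /powR gt_eqF //.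
have h1 : ln (1 + u) <= u.
  by rewrite -ler_expR lnK ?posrE // expR_ge1Dx.
apply: (@le_trans _ _ (expR (r * u))); first by rewrite ler_expR ler_wpM2l // ltW.
have ru0 : 0 < r * u by rewrite mulr_gt0.
have h2 : 1 - r * u <= expR (- (r * u)) := expR_ge1Dx _.
have h3 : 0 < expR (r * u) := expR_gt0 _.
have h4 : (1 - r * u) * expR (r * u) <= 1.
  apply: le_trans (_ : expR (- (r * u)) * expR (r * u) <= 1).
    by rewrite ler_wpM2r // ltW.
  by rewrite -expRD addNr expR0.
have h5 : expR (r * u) * (1 - r * u) <= (1 + 2 * (r * u)) * (1 - r * u).
  rewrite mulrC; apply: le_trans h4 _; nra.
by rewrite -(ler_pM2r (x := 1 - r * u)) //; lra.
Qed.

(** Induction by contradiction: if [D s.+1] exceeded the bound, the recursion would make [D s]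
    exceed [D s.+1] by a factor larger than the ratio of the two bounds. The condition [r * p <= 1]
    bounds [powR (D s.+1) p] below by a multiple of [1/(s+1)]. *)
Lemma sublinear_rate D T C p r : 0 < C -> 0 < p -> 0 < r -> r * p <= 1 ->
  (forall t, 0 <= D t) -> (forall t, D t.+1 <= D t) ->
  (forall t, (T <= t)%N -> powR (D t.+1) (1 + p) <= C * (D t - D t.+1)) ->
  exists a T', 0 < a /\ (0 < T')%N /\
    forall t, (T' <= t)%N -> D t <= a * powR t%:R (- r).
Proof.
move=> C0 p0 r0 rp D0 dD H.
have [m hm] : exists m : nat, 2 * r < m%:R.
  by exists (Num.bound (2 * r)); apply: archi_boundP; lra.
pose T' := maxn T m.+1.
(* Of the 4, one factor 2 is from [powR_1D_le] and one from 1/s <= 2/(s+1); [T'] exceeds [2 * r] so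
   that [powR_1D_le] applies with u = 1/s. *)
pose a0 := powR (4 * r * C) p^-1.
have b0 : 0 <= 4 * r * C by rewrite !mulr_ge0 // ltW.
have a00 : 0 <= a0 by rewrite powR_ge0.
have T'0 : (0 < T')%N by rewrite /T' leq_max orbT.
have tp (t : nat) : (0 < t)%N -> 0 < t%:R :> R by rewrite ltr0n.
pose a := a0 + (D T' + 1) * powR T'%:R r.
have pT' : 0 < powR T'%:R r by rewrite powR_gt0 // tp.
have aT' : 0 < (D T' + 1) * powR T'%:R r by rewrite mulr_gt0 // ltr_wpDl.
have a0' : 0 < a by rewrite /a ltr_wpDl.
exists a, T'; split=> //; split=> // t T't; rewrite -(subnK T't).
elim: (t - T')%N => [|k IH].
  rewrite add0n powRN ler_pdivlMr //; rewrite /a; have := D0 T'; nra.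
rewrite addSn; move: IH; set s := (k + T')%N => IH.
have sT' : (T' <= s)%N by rewrite leq_addl.
have s0 : (0 < s)%N := leq_trans T'0 sT'.
have sR := tp _ s0; have s1R := tp _ (ltn0Sn s).
rewrite leNgt; apply/negP => hgt.
have Ds0 : 0 < D s.+1 by apply: lt_trans hgt; rewrite mulr_gt0 // powR_gt0.
have h := H s (leq_trans (leq_maxl _ _) sT').
rewrite powRD in h; last by rewrite (gt_eqF Ds0) implybT.
rewrite powRr1 ?(ltW Ds0) // in h.
pose w := powR (s.+1)%:R (- r); have w0 : 0 < w by rewrite powR_gt0.
have hp : a `^ p * (s.+1)%:R^-1 <= powR (D s.+1) p.
  apply: (@le_trans _ _ (powR (a * w) p)); last first.
    by apply: ge0_ler_powR; rewrite ?nnegrE ?(ltW p0) ?(ltW Ds0) ?(ltW hgt) // mulr_ge0 ?ltW.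
  rewrite powRM ?(ltW a0') ?(ltW w0) // ler_wpM2l ?powR_ge0 // /w -powRrM.
  rewrite -powR_inv1 ?(ltW s1R) //; apply: ler_powR; first by rewrite ler1n.
  by rewrite mulNr lerN2.
have ap : 4 * r * C <= a `^ p.
  have -> : 4 * r * C = a0 `^ p by rewrite /a0 -powRrM mulVf ?gt_eqF // powRr1.
  by apply: ge0_ler_powR; rewrite ?nnegrE ?(ltW p0) ?(ltW a0') // /a lerDl ltW.
have u0 : 0 < s%:R^-1 :> R by rewrite invr_gt0.
have ru : r * s%:R^-1 <= 2^-1.
  rewrite ler_pdivrMr //; have : m%:R <= s%:R :> R.
    by rewrite ler_nat (leq_trans _ sT') // leq_max leqnSn orbT.
  lra.
have hq := powR_1D_le u0 r0 ru.
have E : powR s%:R (- r) = w * powR (1 + s%:R^-1) r.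
  have -> : 1 + s%:R^-1 = (s.+1)%:R * s%:R^-1 :> R.
    by rewrite -natr1 mulrDl mulfV ?mul1r ?gt_eqF.
  rewrite powRM ?(ltW s1R) ?(ltW u0) // -powR_inv1 ?(ltW sR) // -powRrM mulN1r /w mulrA -powRD; last first.
    by rewrite (gt_eqF s1R) implybT.
  by rewrite addNr powRr0 mul1r.
have h2 : D s <= a * w * (1 + 2 * (r * s%:R^-1)).
  by apply: le_trans IH _; rewrite E [leLHS]mulrA ler_wpM2l // mulr_ge0 ?(ltW a0') ?(ltW w0).
have s2 : s%:R^-1 <= 2 * (s.+1)%:R^-1 :> R.
  rewrite ler_pdivlMr // ler_pdivrMl // -natr1.
  have : 1 <= s%:R :> R by rewrite ler1n.
  lra.
have aw : 0 < a * w by rewrite mulr_gt0.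
have e1 : (a * w) * (C + (s.+1)%:R^-1 * (4 * r * C)) < C * (a * w * (1 + 2 * (r * s%:R^-1))).
  have i0 : 0 < (s.+1)%:R^-1 :> R by rewrite invr_gt0.
  apply: (@lt_le_trans _ _ (D s.+1 * (C + powR (D s.+1) p))); last first.
    apply: (@le_trans _ _ (C * D s)); first by move: h; nra.
    by rewrite ler_wpM2l ?(ltW C0).
  apply: (@lt_le_trans _ _ (D s.+1 * (C + (s.+1)%:R^-1 * (4 * r * C)))).
    by rewrite ltr_pM2r // addr_gt0 // mulr_gt0 // !mulr_gt0.
  rewrite ler_wpM2l ?(ltW Ds0) // lerD2l; apply: le_trans hp.
  by rewrite mulrC ler_wpM2r // ltW.
move: e1; rewrite [ltRHS]mulrCA ltr_pM2l // => e1.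
have := ler_wpM2l (ltW (mulr_gt0 r0 C0)) s2.
move: e1; move: (s%:R^-1) (s.+1%:R^-1) => i j; lra.
Qed.

End RealSequences.

(** * Abstract analysis of the dual iterates *)

Section DualSequence.
Variable R : realType.
Variables (N n : nat) (C : set 'cV[R]_N) (A : 'M[R]_(N, n)) (z xs v : 'cV[R]_n).
Hypothesis vC : econvex C.
Hypotheses (riz : relint C (A *m z)) (Cxs : C (A *m xs)).
Hypothesis rib : relint (preimage_normal C A xs) (v - xs).

(** The optimality conditions of the dual problem; such points are later shown to attain the dual
    value. *)
Definition dual_solutions : set 'cV[R]_N :=
  [set y | normal_cone C (A *m xs) y /\ A^T *m y = v - xs].

Definition normal_holder alpha := exists c r : R, [/\ 0 < r, 0 <= c &
  forall p y : 'cV[R]_N, C p -> enorm (p - A *m xs) < r -> normal_cone C p y ->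
    exists2 w, normal_cone C (A *m xs) w &
    enorm (y - w) <= c * enorm y * powR (enorm (p - A *m xs)) alpha].

Variables (Y P : nat -> 'cV[R]_N).
Hypotheses (CP : forall t, C (P t)) (NP : forall t, normal_cone C (P t) (Y t)).
Variables (X : nat -> 'cV[R]_n) (D : nat -> R).
Hypothesis XE : forall t, A^T *m Y t = v - X t.
Let S t := enorm (Y t.+1 - Y t).
Hypothesis DE : forall t, D t = 2^-1 * inner (X t) (X t) + inner (Y t) (P t)
  - (2^-1 * inner xs xs + inner (v - xs) xs).
Variables c1 c2 : R.
Hypotheses (c10 : 0 < c1) (c20 : 0 <= c2).
Hypothesis descent : forall t, c1 * S t ^+ 2 <= D t - D t.+1.
Hypothesis residual : forall t, enorm (P t.+1 - A *m X t.+1) <= c2 * S t.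

Let S0 t : 0 <= S t := enorm_ge0 _.

(** [P t] attains the support function at [Y t], so [DE] makes [D] the dual gap. The difference of
    the two sides is <Y t, P t - A xs>, nonnegative by normality. *)
Lemma gap_lower t : 2^-1 * enorm (X t - xs) ^+ 2 <= D t.
Proof.
rewrite enorm_sqr inner_sqB DE; have := @NP t _ Cxs; rewrite innerBr.
rewrite (innerC (Y t) (A *m xs)) inner_mulmxl.
rewrite XE innerBl !innerBr (innerC v xs) (innerC (X t) xs); lra.
Qed.

Lemma gap_ge0 t : 0 <= D t.
Proof. by apply: le_trans (gap_lower t); rewrite mulr_ge0 ?sqr_ge0. Qed.

Lemma gap_decr t : D t.+1 <= D t.
Proof.
by have := descent t; have := mulr_ge0 (ltW c10) (sqr_ge0 (S t)); lra.
Qed.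

Lemma gap_le0 t : D t <= D 0.
Proof. by elim: t => // t; apply: le_trans; exact: gap_decr. Qed.

Lemma primal_le_gap t : enorm (X t - xs) <= 2 * Num.sqrt (D t).
Proof.
have h := gap_lower t; rewrite -ler_sqr ?nnegrE ?mulr_ge0 ?sqrtr_ge0 // exprMn (sqr_sqrtr (gap_ge0 t)).
by have := gap_ge0 t; lra.
Qed.

(** The product <P - A X, Y - yb> at [t.+1] exceeds the gap by |X - xs|^2 / 2 + <yb, A xs - P>, and
    both terms are nonnegative. *)
Lemma gap_upper t yb : dual_solutions yb -> D t.+1 <= c2 * S t * enorm (Y t.+1 - yb).
Proof.
move=> [Nb bE]; apply: (@le_trans _ _ (inner (P t.+1 - A *m X t.+1) (Y t.+1 - yb))); last first.
  by apply: le_trans (inner_le _ _) _; rewrite ler_wpM2r.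
have := Nb _ (CP t.+1); have := inner_ge0 (X t.+1 - xs); rewrite inner_sqB.
rewrite (innerBr (P t.+1)) (innerC yb (A *m xs)) inner_mulmxl bE DE.
rewrite (innerBl (P t.+1)) !(innerBr (Y t.+1)) !inner_mulmxl XE bE.
rewrite (innerC (Y t.+1)) (innerC yb) !innerBr innerBl (innerC v); lra.
Qed.

Lemma orth_compl_normal_at p y y' : C p -> normal_cone C p y ->
  orth_compl C (A *m z) y' -> normal_cone C p (y + y').
Proof.
move=> Cp Ny oy u Cu; have := Ny _ Cu; have := oy _ Cu; have := oy _ Cp.
rewrite !innerBr !innerDl; lra.
Qed.

Lemma dual_solutions_shift y y' : A^T *m y' = 0 -> orth_compl C (A *m z) y' ->
  dual_solutions y -> dual_solutions (y + y').
Proof.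
move=> Ay oy [Ny yE]; split; last by rewrite mulmxDr Ay addr0.
exact: orth_compl_normal_at.
Qed.

(** The decreasing gap bounds both the support function at [Y t] and [A^T *m Y t], the data that
    control a representative. *)
Lemma bounded_iterates : exists2 B, 0 <= B & forall t, exists y',
  [/\ A^T *m (Y t - y') = 0, orth_compl C (A *m z) (Y t - y') & enorm y' <= B].
Proof.
have [K K0 KP] := bounded_representative riz.
pose h0 := D 0 + `|2^-1 * inner xs xs + inner (v - xs) xs|.
exists (K * (enorm (v - xs) + 2 * Num.sqrt (D 0) + `|h0|)).
  by rewrite mulr_ge0 ?addr_ge0 ?mulr_ge0 ?sqrtr_ge0.
move=> t; have [|y' [yE oy yB]] := KP (Y t) h0.
  move=> u Cu; have := @NP t _ Cu; rewrite innerBr.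
  have := gap_le0 t; rewrite {1}DE /h0; have := inner_ge0 (X t).
  have := ler_norm (2^-1 * inner xs xs + inner (v - xs) xs); lra.
exists y'; split=> //; first by rewrite mulmxBr yE subrr.
apply: le_trans yB _; rewrite ler_wpM2l // lerD2r.
have -> : A^T *m Y t = (v - xs) - (X t - xs).
  by rewrite XE; apply/colP => i; rewrite !mxE; ring.
apply: le_trans (enormB _ _) _; rewrite lerD2l.
apply: le_trans (primal_le_gap t) _; rewrite ler_pM2l // ler_wsqrtr //.
exact: gap_le0.
Qed.

(** One fixed solution, shifted by the part split off from [Y t], remains a solution at bounded
    distance from [Y t]. *)
Lemma dual_solution_near : exists2 B, 0 <= B & forall t, exists2 yb,
  dual_solutions yb & enorm (Y t - yb) <= B.
Proof.
have [K K0 KP] := normal_cone_regular riz vC Cxs rib.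
(* Existence of a dual solution, from the regularity bound started at 0. *)
have [y0 [N0 E0 _]] := KP 0 (@normal_cone0 _ _ _ _).
have [B B0 BP] := bounded_iterates.
exists (B + enorm y0); first by rewrite addr_ge0.
move=> t; have [y' [yE oy yB]] := BP t.
exists (y0 + (Y t - y')); first exact: dual_solutions_shift.
have -> : Y t - (y0 + (Y t - y')) = y' - y0 by apply/colP => i; rewrite !mxE; ring.
by apply: le_trans (enormB _ _) _; rewrite lerD2r.
Qed.

Lemma step_to0 e : 0 < e -> exists T, forall t, (T <= t)%N -> S t < e.
Proof.
move=> e0; have [|T TP] := @nonincreasing_gap _ D gap_ge0 gap_decr (c1 * e ^+ 2) _.
  by rewrite mulr_gt0 ?exprn_gt0.
exists T => t /TP h; have := le_lt_trans (descent t) h.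
by rewrite ltr_pM2l // ltr_sqr ?nnegrE // ltW.
Qed.

Lemma gap_to0 e : 0 < e -> exists T, forall t, (T <= t)%N -> D t < e.
Proof.
move=> e0; have [B B0 BP] := dual_solution_near.
have k0 : 0 < c2 * B + 1 by rewrite ltr_wpDl ?mulr_ge0.
have [T TP] := step_to0 (divr_gt0 e0 k0).
exists T.+1 => -[//|t] /TP; rewrite ltr_pdivlMr // => h.
have [yb Myb yB] := BP t.+1; have := gap_upper t Myb => h1.
have h2 : c2 * S t * enorm (Y t.+1 - yb) <= c2 * S t * B.
  by rewrite ler_wpM2l // mulr_ge0.
have := S0 t; nra.
Qed.

Lemma primal_cvg e : 0 < e -> exists T, forall t, (T <= t)%N -> enorm (X t - xs) < e.
Proof.
move=> e0; have e2 : 0 < 2^-1 * e ^+ 2 by rewrite mulr_gt0 ?exprn_gt0.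
have [T TP] := gap_to0 e2; exists T => t /TP h.
have := le_lt_trans (gap_lower t) h.
by rewrite ltr_pM2l // ltr_sqr ?nnegrE // ltW.
Qed.

Let W t := S t + Num.sqrt (D t.+1).

Let W0 t : 0 <= W t. Proof. by rewrite addr_ge0 ?sqrtr_ge0. Qed.

Lemma W_to0 e : 0 < e -> exists T, forall t, (T <= t)%N -> W t < e.
Proof.
move=> e0; have e2 : 0 < e / 2 by rewrite divr_gt0.
have [T1 P1] := step_to0 e2.
have [|T2 P2] := @gap_to0 ((e / 2) ^+ 2); first by rewrite exprn_gt0.
exists (maxn T1 T2) => t; rewrite geq_max => /andP[/P1 h1 h2].
have := P2 t.+1 (leqW h2); rewrite -(sqr_sqrtr (gap_ge0 t.+1)) ltr_sqr ?nnegrE ?sqrtr_ge0 ?(ltW e2) //.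
by rewrite /W; lra.
Qed.

Lemma error_bound alpha : 0 < alpha <= 1 -> normal_holder alpha ->
  exists c T, 0 < c /\ forall t, (T <= t)%N -> W t <= 1 /\
    exists2 yb, dual_solutions yb & enorm (Y t.+1 - yb) <= c * powR (W t) alpha.
Proof.
move=> /andP[a0 a1] [c [r [r0 c0 NH]]].
have [M M0 MP] := mulmx_bound A; have [M' M'0 MP'] := mulmx_bound A^T.
have [B B0 BP] := bounded_iterates.
have [K K0 KP] := normal_cone_regular riz vC Cxs rib.
(* Chosen so that [P t.+1] is within [k * W t] of [A *m xs]: [c2] for the residual, [M * 2] for the
   primal error. *)
pose k := c2 + M * 2 + 1.
have k0 : 0 < k by rewrite /k ltr_wpDl // addr_ge0 ?mulr_ge0.
have [q [q0 qE]] : exists q, 0 <= q /\ q = c * B * powR k alpha.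
  by exists (c * B * powR k alpha); rewrite !mulr_ge0 ?powR_ge0.
exists (q + K * (M' * q + 2) * (1 + B + q) + 1).
have c'0 : 0 < q + K * (M' * q + 2) * (1 + B + q) + 1.
  have Mq : 0 <= M' * q by rewrite mulr_ge0.
  have KM : 0 <= K * (M' * q + 2) by apply: mulr_ge0 => //; lra.
  have Bq : 0 <= 1 + B + q by lra.
  by have := mulr_ge0 KM Bq; lra.
have [T TP] : exists T, forall t, (T <= t)%N -> W t < Num.min 1 (r / k).
  by apply: W_to0; rewrite lt_min ltr01 divr_gt0.
exists T; split=> // t /TP; rewrite lt_min => /andP[w1 wr]; split; first exact: ltW.
have hX : enorm (X t.+1 - xs) <= 2 * W t.
  by apply: le_trans (primal_le_gap _) _; rewrite ler_pM2l // lerDr.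
have hP : enorm (P t.+1 - A *m xs) <= k * W t.
  apply: le_trans (enorm_tri _ (A *m X t.+1) _) _; rewrite -mulmxBr.
  have h1 := residual t; have h2 := MP (X t.+1 - xs).
  have h3 : c2 * S t <= c2 * W t by rewrite ler_wpM2l // lerDl sqrtr_ge0.
  have h4 : M * enorm (X t.+1 - xs) <= M * (2 * W t) by rewrite ler_wpM2l.
  rewrite /k; have := W0 t; lra.
have hPr : enorm (P t.+1 - A *m xs) < r.
  by apply: le_lt_trans hP _; rewrite mulrC -ltr_pdivlMr.
(* The Hoelder estimate has a factor [enorm y], so it is applied to the bounded [y'], which is still
   normal at [P t.+1]. *)
have [y' [yE oy yB]] := BP t.+1.
have Ny' : normal_cone C (P t.+1) y'.
  have := orth_compl_normal_at (CP _) (NP t.+1) (orth_complN oy).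
  by rewrite subKr.
have [w Nw wy] := NH _ _ (CP _) hPr Ny'.
set wa := powR (W t) alpha.
have wa0 : 0 <= wa by rewrite powR_ge0.
have wwa : W t <= wa.
  have [->|Wn] := eqVneq (W t) 0; first exact: wa0.
  by apply: ger1_powR => //; rewrite lt_def Wn W0 ltW.
have wa1 : wa <= 1.
  apply: (@le_trans _ _ (powR 1 alpha)); last by rewrite powR1.
  by apply: ge0_ler_powR; rewrite ?nnegrE ?(ltW a0) ?(ltW w1).
have wy' : enorm (y' - w) <= q * wa.
  apply: le_trans wy _; rewrite qE -[leRHS]mulrA; apply: ler_pM; rewrite ?mulr_ge0 ?powR_ge0 //.
    by rewrite ler_wpM2l.
  rewrite -powRM ?(ltW k0) //; apply: ge0_ler_powR; rewrite ?nnegrE ?(ltW a0) //.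
  by rewrite mulr_ge0 ?(ltW k0).
have [yb [Nyb ybE wyb]] := KP _ Nw.
exists (yb + (Y t.+1 - y')); first exact: dual_solutions_shift.
have -> : Y t.+1 - (yb + (Y t.+1 - y')) = (y' - w) + (w - yb).
  by apply/colP => i; rewrite !mxE; ring.
apply: le_trans (enormD _ _) _.
have hw : enorm w <= B + q.
  have := enormB y' (y' - w); rewrite subKr.
  have : q * wa <= q by rewrite ler_piMr.
  lra.
have hA : enorm (A^T *m w - (v - xs)) <= (M' * q + 2) * wa.
  have -> : A^T *m w - (v - xs) = - (A^T *m (y' - w)) - (X t.+1 - xs).
    move: yE; rewrite !mulmxBr XE => /subr0_eq <-.
    by apply/colP => i; rewrite !mxE; ring.
  apply: le_trans (enormB _ _) _; rewrite enormN.
  have h1 := MP' (y' - w).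
  have h2 : M' * enorm (y' - w) <= M' * (q * wa) by rewrite ler_wpM2l.
  lra.
have h5 : K * enorm (A^T *m w - (v - xs)) * (1 + enorm w) <=
    K * ((M' * q + 2) * wa) * (1 + B + q).
  apply: ler_pM; rewrite ?mulr_ge0 ?addr_ge0 //; first by rewrite ler_wpM2l.
  by rewrite -addrA lerD2l.
have h6 := le_trans wyb h5; move: h6 wy'.
by move: (enorm (y' - w)) (enorm (w - yb)) => e1 e2; lra.
Qed.

Lemma gap_recursion alpha : 0 < alpha <= 1 -> normal_holder alpha ->
  exists k T, 0 < k /\ forall t, (T <= t)%N ->
    powR (D t.+1) (2 - alpha) <= k * (D t - D t.+1).
Proof.
move=> ha NH; have [c [T [c0 H]]] := error_bound ha NH.
have /andP[a0 a1] := ha.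
(* One summand for each of the regimes [g <= S t] and [S t < g]. *)
exists (c1^-1 + (2 * c2 * c) ^+ 2 / c1), T; split.
  by rewrite ltr_wpDr ?invr_gt0 // divr_ge0 ?sqr_ge0 // ltW.
move=> t /H [w1 [yb My yW]]; set g := Num.sqrt (D t.+1).
have g0 : 0 <= g := sqrtr_ge0 _.
have gE : D t.+1 = g ^+ 2 by rewrite sqr_sqrtr // gap_ge0.
have dS : S t ^+ 2 <= (D t - D t.+1) / c1.
  by rewrite ler_pdivlMr // mulrC descent.
have d0 : 0 <= D t - D t.+1 by rewrite subr_ge0 gap_decr.
have g1 : g <= 1 by move: w1; rewrite /W -/g; have := S0 t; lra.
have G1 : g ^+ 2 <= 1 by rewrite expr_le1.
rewrite gE mulrDl -gE.
have Q0 : 0 <= (2 * c2 * c) ^+ 2 / c1 * (D t - D t.+1).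
  by rewrite mulr_ge0 ?divr_ge0 ?sqr_ge0 ?(ltW c10).
have [gn0|gn0] := eqVneq g 0.
  rewrite gE gn0 expr0n /= powR0; last by rewrite gt_eqF //; lra.
  by rewrite subr0; have := gap_ge0 t; move: d0 Q0; rewrite gE gn0 expr0n /= subr0 => ? ? ?;
     rewrite addr_ge0 // mulr_ge0 // invr_ge0 ltW.
have gp : 0 < g by rewrite lt_def gn0.
have [gS|Sg] := leP g (S t).
  apply: (@le_trans _ _ (D t.+1)).
    rewrite gE; apply: ge1r_powR; last lra.
    by rewrite G1 exprn_gt0.
  rewrite -[leLHS]addr0; apply: lerD => //.
  rewrite mulrC; apply: le_trans dS; rewrite gE ler_sqr ?nnegrE //.
have Wg : W t <= 2 * g by rewrite /W -/g; lra.
have Wa : powR (W t) alpha <= 2 * powR g alpha.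
  apply: (@le_trans _ _ (powR (2 * g) alpha)).
    by apply: ge0_ler_powR; rewrite ?nnegrE ?mulr_ge0 ?(ltW a0).
  rewrite powRM ?(ltW gp) // ler_pM2r ?powR_gt0 //.
  have two1 : (1 : R) <= 2 by rewrite ler1n.
  exact: (@ler1_powR _ 2 alpha two1 a1).
have h1 : g ^+ 2 <= (2 * c2 * c) * S t * powR g alpha.
  rewrite -gE; apply: le_trans (gap_upper t My) _.
  apply: (@le_trans _ _ (c2 * S t * (c * (2 * powR g alpha)))); last by rewrite le_eqVlt; apply/orP; left; apply/eqP; ring.
  rewrite ler_wpM2l ?mulr_ge0 //; apply: le_trans yW _.
  by rewrite ler_wpM2l // ltW.
have ga : 0 < powR g alpha by rewrite powR_gt0.
have h2 : powR g (2 - alpha) <= (2 * c2 * c) * S t.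
  rewrite -(ler_pM2r ga) -powRD; last by rewrite (gt_eqF gp) implybT.
  by rewrite subrK powR_mulrn.
apply: (@le_trans _ _ ((2 * c2 * c) ^+ 2 / c1 * (D t - D t.+1))); last first.
  by rewrite lerDr mulr_ge0 // invr_ge0 ltW.
have -> : powR (D t.+1) (2 - alpha) = powR g (2 - alpha) ^+ 2.
  by rewrite gE -(powR_mulrn 2 g0) -powRrM mulrC powRrM powR_mulrn ?powR_ge0.
apply: (@le_trans _ _ (((2 * c2 * c) * S t) ^+ 2)).
  by rewrite ler_sqr ?nnegrE ?powR_ge0 // !mulr_ge0 ?(ltW c0).
rewrite exprMn -[leRHS]mulrA ler_wpM2l ?sqr_ge0 //.
by rewrite mulrC.
Qed.

Lemma dual_solutions_eclosed : eclosed dual_solutions.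
Proof.
move=> y h; split.
  by apply: normal_cone_eclosed => e /h [c [Nc _] cy]; exists c.
have [M M0 MP] := mulmx_bound A^T.
apply/eqP; rewrite -subr_eq0; apply/eqP/enorm_eq0/le_anti; rewrite enorm_ge0 andbT.
apply/ler_addgt0Pr => e e0; rewrite add0r.
have M1 : 0 < M + 1 by lra.
have [c [_ cE]] := h _ (divr_gt0 e0 M1); rewrite ltr_pdivlMr // => cy.
rewrite -cE -mulmxBr; apply: le_trans (MP _) _; rewrite enormBC.
have := enorm_ge0 (c - y); nra.
Qed.

Lemma step_le_gap t : S t <= Num.sqrt (D t / c1).
Proof.
have hd : 0 <= D t / c1 by rewrite divr_ge0 ?gap_ge0 // ltW.
rewrite -ler_sqr ?nnegrE ?sqrtr_ge0 // (sqr_sqrtr hd).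
rewrite ler_pdivlMr // mulrC; apply: le_trans (descent t) _.
by have := gap_ge0 t.+1; lra.
Qed.

Lemma dual_cvg alpha : 0 < alpha <= 1 -> normal_holder alpha ->
  forall e, 0 < e -> exists T, forall t, (T <= t)%N ->
    exists2 yb, dual_solutions yb & enorm (Y t - yb) < e.
Proof.
move=> ha NH e e0; have [c [T [c0 H]]] := error_bound ha NH.
have /andP[a0 a1] := ha.
have ec : 0 < e / c by rewrite divr_gt0.
have [|T' H'] := @W_to0 (powR (e / c) alpha^-1); first by rewrite powR_gt0.
exists (maxn T T').+1 => -[//|t]; rewrite ltnS geq_max => /andP[/H [_ [yb My yW]] /H' h].
exists yb => //; apply: le_lt_trans yW _; rewrite mulrC -ltr_pdivlMr //.
have -> : e / c = powR (powR (e / c) alpha^-1) alpha.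
  by rewrite -powRrM mulVf ?gt_eqF // powRr1 // ltW.
by apply: gt0_ltr_powR; rewrite ?in_itv /= ?andbT ?nnegrE ?powR_ge0.
Qed.

(** Steps are bounded by the square root of the gap, so they decay at rate [rho], the square root of
    the rate of the gap. The dual iterates are then Cauchy, and [dual_cvg] places their limit among
    the solutions. *)
Lemma linear_cvg : normal_holder 1 -> exists ys a1 a0 T,
  [/\ dual_solutions ys, 0 < a1, 0 < a0 < 1 & forall t, (T <= t)%N ->
    enorm (X t - xs) <= a1 * a0 ^+ t /\ enorm (Y t - ys) <= a1 * a0 ^+ t].
Proof.
move=> NH; have h1 : 0 < (1 : R) <= 1 by rewrite (@ltr01 R) (@lexx _ R).
have [k [T [k0 kP]]] := gap_recursion h1 NH.
have [|a a0 aP] := @linear_rate _ D T k k0 gap_ge0.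
  move=> t /kP; have -> : 2 - 1 = 1 :> R by ring.
  by rewrite powRr1 // gap_ge0.
pose q := k / (1 + k); pose rho := Num.sqrt q.
have q0 : 0 < q by rewrite divr_gt0 // addr_gt0.
have q1 : q < 1 by rewrite ltr_pdivrMr ?addr_gt0 // mul1r; lra.
have r0 : 0 < rho by rewrite sqrtr_gt0.
have r1 : rho < 1 by rewrite -sqrtr1 ltr_sqrt.
have rE t : Num.sqrt (q ^+ t) = rho ^+ t.
  by rewrite -(sqr_sqrtr (ltW q0)) -/rho -exprM mulnC exprM sqrtr_sqr ger0_norm // exprn_ge0 // ltW.
pose b := Num.sqrt (a / c1).
have b0 : 0 < b by rewrite sqrtr_gt0 divr_gt0.
have Sle t : (T <= t)%N -> S t <= b * rho ^+ t.
  move=> Tt; apply: le_trans (step_le_gap t) _.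
  rewrite -rE -sqrtrM ?divr_ge0 ?(ltW a0) ?(ltW c10) // ler_wsqrtr //.
  by rewrite mulrAC ler_wpM2r ?invr_ge0 ?(ltW c10) // aP.
have r1' : 0 < 1 - rho by lra.
(* Keeping the partial geometric sum, with its factor [1 - rho ^+ m], makes the induction exact. *)
have tail t m : (T <= t)%N -> enorm (Y (m + t)%N - Y t) <= b / (1 - rho) * (1 - rho ^+ m) * rho ^+ t.
  move=> Tt; elim: m => [|m IH].
    by rewrite add0n subrr enorm0 expr0 subrr mulr0 mul0r.
  rewrite addSn; apply: le_trans (enorm_tri _ (Y (m + t)%N) _) _.
  have := Sle _ (leq_trans Tt (leq_addl m t)); rewrite -/(S (m + t)%N) => h.
  have E : b / (1 - rho) * (1 - rho ^+ m.+1) * rho ^+ t =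
      b * rho ^+ (m + t) + b / (1 - rho) * (1 - rho ^+ m) * rho ^+ t.
    by rewrite exprD exprS; field; exact: lt0r_neq0.
  by rewrite E; apply: lerD.
have tail' t m : (T <= t)%N -> enorm (Y (m + t)%N - Y t) <= b / (1 - rho) * rho ^+ t.
  move=> Tt; apply: le_trans (tail t m Tt) _; rewrite ler_wpM2r ?exprn_ge0 ?(ltW r0) //.
  by rewrite ler_piMr ?divr_ge0 ?(ltW b0) ?(ltW r1') // gerBl exprn_ge0 // ltW.
have [ys ysP] := @enorm_bounded_cluster _ _ (fun m => Y (m + T)%N)
  (enorm (Y T) + b / (1 - rho) * rho ^+ T) (fun m => ltac:(
    have := enormD (Y (m + T)%N - Y T) (Y T); rewrite subrK;
    have := tail' T m (leqnn _); lra)).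
have lim t : (T <= t)%N -> enorm (Y t - ys) <= b / (1 - rho) * rho ^+ t.
  move=> Tt; apply/ler_addgt0Pr => e e0; have [m tm h] := ysP e t e0.
  have tm' : (t <= m + T)%N by rewrite (leq_trans tm) // leq_addr.
  have := tail' t (m + T - t)%N Tt; rewrite subnK // => h2.
  by have := enorm_tri (Y t) (Y (m + T)%N) ys; rewrite (enormBC (Y t) (Y (m + T)%N)); lra.
exists ys, (b / (1 - rho) + 2 * Num.sqrt a), rho, T; split.
- apply: dual_solutions_eclosed => e e0; have e2 : 0 < e / 2 by rewrite divr_gt0.
  have [T' H'] := dual_cvg h1 NH e2.
  have [m Tm mP] := ysP _ T' e2.
  have [yb My yh] := H' (m + T)%N (leq_trans Tm (leq_addr _ _)).
  exists yb => //; have := enorm_tri yb (Y (m + T)%N) ys.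
  by rewrite (enormBC yb (Y (m + T)%N)); lra.
- by rewrite ltr_wpDr ?mulr_ge0 ?sqrtr_ge0 // divr_gt0.
- by rewrite r0.
move=> t Tt; have p0 : 0 <= rho ^+ t by rewrite exprn_ge0 // ltW.
have s0 : 0 <= 2 * Num.sqrt a by rewrite mulr_ge0 ?sqrtr_ge0.
have s1 : 0 <= b / (1 - rho) by rewrite divr_ge0 ?ltW.
split; last first.
  by apply: le_trans (lim t Tt) _; rewrite ler_wpM2r // lerDl.
apply: le_trans (primal_le_gap t) _.
apply: (@le_trans _ _ (2 * Num.sqrt a * rho ^+ t)); last by rewrite ler_wpM2r // lerDr.
rewrite -mulrA ler_pM2l // -rE -sqrtrM ?(ltW a0) // ler_wsqrtr //.
exact: aP.
Qed.

(** The recursion has exponent 1 + (1 - beta). Once the gap is below 1, its square root is at most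
    its power [beta / 2], which gives the primal rate; the dual rate follows from [error_bound] and
    W_t = O(sqrt D_t). *)
Lemma sublinear_cvg beta : 0 < beta < 1 -> normal_holder beta ->
  let r := beta / (1 - beta) in exists a T, 0 < a /\ forall t, (T <= t)%N ->
  [/\ enorm (X t - xs) <= a * powR t%:R (- (beta / 2 * r)),
      D t <= a * powR t%:R (- r) &
      exists2 yb, dual_solutions yb & enorm (Y t - yb) <= a * powR t%:R (- (beta / 2 * r))].
Proof.
move=> /andP[b0 b1] NH r; have hb : 0 < beta <= 1 by rewrite b0 ltW.
have b1' : 0 < 1 - beta by lra.
have r0 : 0 < r by rewrite divr_gt0.
have [k [T1 [k0 kP]]] := gap_recursion hb NH.
have [||a [T2 [a0 [T20 aP]]]] := @sublinear_rate _ D T1 k (1 - beta) r k0 b1' r0 _ gap_ge0 gap_decr.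
- by rewrite divfK ?gt_eqF // ltW.
- by move=> t /kP; congr (powR _ _ <= _); ring.
have [c [T3 [c0 cP]]] := error_bound hb NH.
have [T4 P4] := gap_to0 ltr01.
pose s := beta / 2 * r.
have s0 : 0 < s by rewrite mulr_gt0 ?divr_gt0.
have half0 : 0 <= beta / 2 by rewrite divr_ge0 // ltW.
have gapb t : (T2 <= t)%N -> powR (D t) (beta / 2) <= powR a (beta / 2) * powR t%:R (- s).
  move=> /aP h; apply: le_trans (_ : powR (a * powR t%:R (- r)) (beta / 2) <= _).
    by apply: ge0_ler_powR; rewrite ?half0 ?nnegrE ?gap_ge0 ?mulr_ge0 ?powR_ge0 ?(ltW a0).
  have -> : - s = - r * (beta / 2) by rewrite /s; ring.
  by rewrite powRM ?powR_ge0 ?(ltW a0) // -powRrM.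
have sqb t : (T4 <= t)%N -> Num.sqrt (D t) <= powR (D t) (beta / 2).
  move=> /P4 h; rewrite -powR12_sqrt ?gap_ge0 //.
  have [->|Dn] := eqVneq (D t) 0.
    by rewrite !powR0 // gt_eqF ?divr_gt0 ?invr_gt0.
  by apply: ger_powR; [rewrite lt_def Dn gap_ge0 ltW | lra].
pose c' := c * powR (Num.sqrt c1^-1 + 1) beta.
pose ab := powR a (beta / 2).
have ab0 : 0 < ab by rewrite powR_gt0.
have c'0 : 0 < c' by rewrite mulr_gt0 // powR_gt0 // ltr_wpDl ?sqrtr_ge0.
have p2 : 0 < powR 2 s by rewrite powR_gt0.
exists (a + 2 * ab + c' * ab * powR 2 s), (maxn (maxn T2 T3) T4).+1; split.
  by rewrite !addr_gt0 ?mulr_gt0.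
have w0 : 0 < c' * ab * powR 2 s by rewrite !mulr_gt0.
move=> -[//|t]; rewrite ltnS !geq_max => /andP[/andP[h2 h3] h4].
have t0 : (0 < t)%N by exact: leq_trans h2.
have ps : 0 <= powR (t.+1)%:R (- s) by rewrite powR_ge0.
split.
- apply: le_trans (primal_le_gap _) _.
  apply: (@le_trans _ _ (2 * (ab * powR (t.+1)%:R (- s)))).
    rewrite ler_pM2l //; apply: le_trans (sqb _ (leqW h4)) _; exact: gapb (leqW h2).
  have : 2 * ab <= a + 2 * ab + c' * ab * powR 2 s by move: w0; lra.
  by move=> h; rewrite [leLHS]mulrA; exact: (ler_wpM2r ps h).
- apply: le_trans (aP _ (leqW h2)) _; rewrite ler_wpM2r ?powR_ge0 //.
  have : 0 < 2 * ab by rewrite mulr_gt0.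
  by move: w0; lra.
have [_ [yb My yW]] := cP t h3; exists yb => //; apply: le_trans yW _.
have g0 := sqrtr_ge0 (D t).
have WD : W t <= (Num.sqrt c1^-1 + 1) * Num.sqrt (D t).
  rewrite /W mulrDl mul1r; apply: lerD.
    by apply: le_trans (step_le_gap t) _; rewrite mulrC sqrtrM // invr_ge0 ltW.
  by rewrite ler_wsqrtr // gap_decr.
have k1 : 0 <= Num.sqrt c1^-1 + 1 by rewrite addr_ge0 ?sqrtr_ge0.
have WDb : powR (W t) beta <= powR (Num.sqrt c1^-1 + 1) beta * powR (D t) (beta / 2).
  have -> : powR (D t) (beta / 2) = powR (Num.sqrt (D t)) beta.
    by rewrite -powR12_sqrt ?gap_ge0 // -powRrM mulrC.
  rewrite -powRM //; apply: ge0_ler_powR; rewrite ?nnegrE ?mulr_ge0 ?(ltW b0) //.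
apply: (@le_trans _ _ (c' * (ab * powR t%:R (- s)))).
  apply: (@le_trans _ _ (c' * powR (D t) (beta / 2))).
    by rewrite /c' -mulrA ler_wpM2l // ltW.
  by rewrite ler_wpM2l ?(ltW c'0) // gapb.
(* The distance at [t.+1] is bounded through the gap at [t]; the factor [powR 2 s] pays for this
   shift. *)
have tt : powR t%:R (- s) <= powR 2 s * powR (t.+1)%:R (- s).
  rewrite !powRN ler_pdivlMr ?powR_gt0 ?ltr0n // mulrC ler_pdivrMr ?powR_gt0 ?ltr0n //.
  rewrite -powRM ?ler0n //; apply: ge0_ler_powR; rewrite ?nnegrE ?(ltW s0) ?mulr_ge0 ?ler0n //.
  have : (1 : R) <= t%:R by rewrite ler1n.
  by rewrite -natr1; lra.
apply: (@le_trans _ _ (c' * ab * powR 2 s * powR (t.+1)%:R (- s))).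
  by rewrite mulrA -[leRHS]mulrA ler_wpM2l // ltW // mulr_gt0.
apply: (ler_wpM2r ps); rewrite lerDr.
have : 0 < 2 * ab by rewrite mulr_gt0.
by move: a0; lra.
Qed.

End DualSequence.

(** * The largest eigenvalue and product spaces *)

Section LambdaMax.
Variable R : realType.

Lemma max_stretch k n (A : 'M[R]_(k, n)) : (0 < n)%N ->
  exists2 x, enorm x = 1 & forall z, enorm (A *m z) <= enorm (A *m x) * enorm z.
Proof.
move=> n0; have [K K0 KP] := mulmx_bound A.
pose S := [set x : 'cV[R]_n | enorm x = 1].
have [|x e|x Sx|x Sx|x e Sx e0|x Sx xm] :=
    @exists_minimizer _ _ S (fun x => K - enorm (A *m x)) 1.
- exists (delta_mx (Ordinal n0) ord0); rewrite /S /= /enorm /inner.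
  rewrite (bigD1 (Ordinal n0)) //= !mxE !eqxx mulr1 big1 ?addr0 ?sqrtr1 // => i ij.
  by rewrite !mxE (negbTE ij) mulr0.
- apply/eqP; rewrite -subr_eq0 -normr_le0; apply/ler_addgt0Pr => d /e [c cE cx].
  rewrite add0r -cE; have := enorm_tri x c 0; have := enorm_tri c x 0.
  by rewrite !subr0 (enormBC x c) ler_norml => ? ?; apply/andP; split; lra.
- by rewrite Sx.
- by rewrite subr_ge0; have := KP x; rewrite Sx mulr1.
- have k1 : 0 < K + 1 by lra.
  exists (e / (K + 1)); first by rewrite divr_gt0.
  move=> z _; rewrite ltr_pdivlMr // => zx.
  have := enorm_tri (A *m z) (A *m x) 0; rewrite !subr0 -mulmxBr.
  have := KP (z - x); have := enorm_ge0 (z - x); nra.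
exists x => // z; have [zz|zn0] := eqVneq (enorm z) 0.
  by rewrite zz mulr0 (enorm_eq0 zz) mulmx0 enorm0.
have z0 : 0 < enorm z by rewrite lt_def zn0 enorm_ge0.
have := xm ((enorm z)^-1 *: z); rewrite /S /= enormZ ger0_norm ?invr_ge0 // mulVf //.
move=> /(_ erefl); rewrite lerD2l lerN2 -scalemxAr enormZ ger0_norm ?invr_ge0 //.
by rewrite ler_pdivrMl // mulrC.
Qed.

(** A unit vector of maximal stretch is an eigenvector of [A^T *m A], so the largest eigenvalue
    exists and the default value 0 in [lambda_max] is not taken. The bound for [A^T] uses |A^T u|^2
    = <u, A A^T u>. *)
Lemma lambda_maxP k n (A : 'M[R]_(k, n)) : (0 < n)%N -> A != 0 ->
  0 < lambda_max (A^T *m A) /\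
  forall u, enorm (A^T *m u) ^+ 2 <= lambda_max (A^T *m A) * enorm u ^+ 2.
Proof.
move=> n0 A0; have [x x1 xm] := max_stretch A n0.
set s := enorm (A *m x) in xm; have s0 : 0 <= s := enorm_ge0 _.
have xx : inner x x = 1 by rewrite -enorm_sqr x1 expr1n.
have ss : inner (A *m x) (A *m x) = s ^+ 2 by rewrite -enorm_sqr.
have eig : A^T *m A *m x = s ^+ 2 *: x.
  suff H h : s ^+ 2 * inner x h - inner (A *m x) (A *m h) = 0.
    apply/eqP; rewrite eq_sym -subr_eq0; apply/eqP/inner_eq0.
    by rewrite {1}innerBl innerZl -mulmxA (innerC (A^T *m _)) -inner_mulmxl
      (innerC (A *m _)) H.
  set b := _ - _; pose c := s ^+ 2 * inner h h - inner (A *m h) (A *m h).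
  have q t : 0 <= 2 * t * b + t ^+ 2 * c.
    have := xm (x + t *: h); rewrite -ler_sqr ?nnegrE ?mulr_ge0 // exprMn !enorm_sqr.
    rewrite mulmxDr -scalemxAr !inner_sqD !innerZr !innerZl xx ss /b /c; lra.
  have c0 : 0 <= c by have := q 1; have := q (-1); rewrite sqrrN !expr1n; lra.
  have c1 : 0 < c + 1 by lra.
  (* Here the nonnegative quadratic 2tb + t^2 c equals -(b/(c+1))^2 (c+2), which forces [b] to
     vanish. *)
  have := q (- b / (c + 1)).
  have -> : 2 * (- b / (c + 1)) * b + (- b / (c + 1)) ^+ 2 * c =
    - (b / (c + 1)) ^+ 2 * (c + 2) by field; exact: lt0r_neq0.
  rewrite mulNr oppr_ge0 => h1.
  have : (b / (c + 1)) ^+ 2 <= 0.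
    by rewrite -(ler_pM2r (_ : 0 < c + 2)) ?mul0r //; lra.
  rewrite le_eqVlt ltNge sqr_ge0 orbF sqrf_eq0 mulf_eq0 invr_eq0 (gt_eqF c1) orbF.
  by move/eqP.
have sym : (A^T *m A)^T = A^T *m A by rewrite trmx_mul trmxK.
have es : eigenvalue (A^T *m A) (s ^+ 2).
  apply/eigenvalueP; exists x^T; last first.
    apply/eqP => /(congr1 trmx); rewrite trmxK trmx0 => x0.
    by move: xx; rewrite x0 inner0l => /eqP; rewrite eq_sym oner_eq0.
  by apply: trmx_inj; rewrite trmx_mul sym trmxK eig linearZ /= trmxK.
have le b : eigenvalue (A^T *m A) b -> b <= s ^+ 2.
  move=> /eigenvalueP[v vb v0].
  have vE : A^T *m A *m v^T = b *: v^T.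
    by apply: trmx_inj; rewrite trmx_mul sym trmxK vb linearZ /= trmxK.
  have h := xm v^T.
  have : enorm (A *m v^T) ^+ 2 <= (s * enorm v^T) ^+ 2 by rewrite ler_sqr ?nnegrE ?mulr_ge0.
  rewrite exprMn !enorm_sqr inner_mulmxl mulmxA vE innerZr ler_pM2r //.
  rewrite lt_def inner_ge0 andbT; apply: contra_neq v0 => /inner_eq0 e.
  by rewrite -(trmxK v) e trmx0.
have -> : lambda_max (A^T *m A) = s ^+ 2.
  rewrite /lambda_max; case: xgetP => [a _ [ea la]|h]; last by case: (h (s ^+ 2)).
  by apply/le_anti; rewrite le // la.
have sp : 0 < s.
  rewrite lt_def s0 andbT; apply: contra_neq A0 => s00.
  have z (w : 'cV[R]_n) : A *m w = 0.
    by apply/enorm_eq0/le_anti; rewrite enorm_ge0 andbT; have := xm w; rewrite s00 mul0r.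
  apply/matrixP => i j; have /colP/(_ i) := z (delta_mx j ord0).
  by rewrite -colE !mxE.
split; first by rewrite exprn_gt0.
move=> u; have := inner_le u (A *m (A^T *m u)); rewrite (innerC u) inner_mulmxl -enorm_sqr.
have := xm (A^T *m u); have := enorm_ge0 u; have := enorm_ge0 (A^T *m u).
move: (enorm (A *m _)) (enorm (A^T *m u)) (enorm u) => p q w q0 w0 h1 h2.
have [->|qn] := eqVneq q 0; first by rewrite expr0n /= mulr_ge0 ?sqr_ge0.
have q1 : 0 < q by rewrite lt_def qn.
have h3 : q <= s * w.
  rewrite -(ler_pM2r q1) -expr2; apply: le_trans h2 _.
  by rewrite mulrC [leRHS]mulrAC ler_wpM2r.
by rewrite -exprMn ler_sqr ?nnegrE // mulr_ge0.
Qed.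

End LambdaMax.

(** * Block vectors and products of sets *)

Section Stacking.
Variable R : realType.
Variables (l : nat) (m : 'I_l -> nat).
Local Notation N := (\sum_i m i)%N.
Implicit Types u v : 'cV[R]_N.

Lemma inner_stack u v : inner u v = \sum_i inner (submxcol u i) (submxcol v i).
Proof.
have innerM k (a b : 'cV[R]_k) : inner a b = (a^T *m b) ord0 ord0.
  by rewrite mxE; apply: eq_bigr => j _; rewrite mxE.
rewrite innerM -{1}(submxcolK u) -{1}(submxcolK v) tr_mxcol mul_mxrow_mxcol summxE.
by apply: eq_bigr => i _; rewrite innerM.
Qed.

Lemma submxcolZ (t : R) u i : submxcol (t *: u) i = t *: submxcol u i.
Proof. by apply/colP => j; rewrite !mxE. Qed.

Lemma enorm_submxcol u i : enorm (submxcol u i) <= enorm u.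
Proof.
by rewrite le_enorm_sqr (inner_stack u) (bigD1 i) //= lerDl sumr_ge0 // => j _; exact: inner_ge0.
Qed.

Lemma enorm_stack_le u : enorm u <= \sum_i enorm (submxcol u i).
Proof.
have s0 : 0 <= \sum_i enorm (submxcol u i) by apply: sumr_ge0 => i _; exact: enorm_ge0.
rewrite -ler_sqr ?nnegrE // enorm_sqr inner_stack expr2 mulr_suml.
apply: ler_sum => i _; rewrite -enorm_sqr expr2 ler_wpM2l //.
by rewrite (bigD1 i) //= lerDl sumr_ge0.
Qed.

Definition stack (y : forall i, 'cV[R]_(m i)) : 'cV[R]_N := \mxcol_i y i.

Lemma stackK y i : submxcol (stack y) i = y i.
Proof. exact: mxcolK. Qed.

Lemma ynorm_stack (y : forall i, 'cV[R]_(m i)) : ynorm y = enorm (stack y).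
Proof. by rewrite /enorm inner_stack /ynorm; under [in RHS]eq_bigr do rewrite stackK. Qed.

Definition update u i (c : 'cV[R]_(m i)) : 'cV[R]_N :=
  stack (eqtype.dfwith (fun j => submxcol u j) c).

Lemma update_in u i c : submxcol (@update u i c) i = c.
Proof. by rewrite stackK eqtype.dfwith_in. Qed.

Lemma update_out u i c j : i != j -> submxcol (@update u i c) j = submxcol u j.
Proof. by move=> ij; rewrite stackK eqtype.dfwith_out. Qed.

Lemma finite_lower_bound (F : 'I_l -> R) : (forall i, 0 < F i) ->
  exists2 e, 0 < e & forall i, e <= F i.
Proof.
move=> F0; exists (\big[Num.min/1]_i F i).
  by apply/bigmin_gtP; split.
by move=> i; apply: bigmin_le_cond.
Qed.

Variable C : forall i, set 'cV[R]_(m i).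
Arguments C : clear implicits.

Definition prodset : set 'cV[R]_N := [set u | forall i, C i (submxcol u i)].

Lemma prodset_update u i c : prodset u -> C i c -> prodset (update u c).
Proof.
move=> Cu Cc j; have [<-|ij] := eqVneq i j; first by rewrite update_in.
by rewrite update_out.
Qed.

Lemma prodset_econvex : (forall i, econvex (C i)) -> econvex prodset.
Proof.
by move=> vC x y t Cx Cy t01 i; rewrite submxcolD !submxcolZ; apply: vC.
Qed.

Lemma normal_cone_stack p u : (forall i, normal_cone (C i) (submxcol p i) (submxcol u i)) ->
  normal_cone prodset p u.
Proof.
move=> Nu w Cw; rewrite inner_stack; apply: sumr_le0 => i _.
by rewrite submxcolB; apply: Nu.
Qed.

Lemma inner_update_diff v u i c : inner v (@update u i c - u) = inner (submxcol v i) (c - submxcol u i).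
Proof.
rewrite inner_stack (bigD1 i) //= [X in _ + X]big1 ?addr0 => [|j ji].
  by rewrite submxcolB update_in.
by rewrite submxcolB update_out 1?eq_sym // subrr inner0r.
Qed.

Lemma normal_cone_unstack p u : prodset p -> normal_cone prodset p u ->
  forall i, normal_cone (C i) (submxcol p i) (submxcol u i).
Proof.
move=> Cp Nu i c Cc; have := Nu _ (prodset_update Cp Cc).
by rewrite inner_update_diff.
Qed.

(** A functional constant on one block, extended by zero ([update 0 o]), is constant on the product;
    hence the blocks of an admissible displacement are admissible. *)
Lemma relint_stack a : (forall i, relint (C i) (submxcol a i)) -> relint prodset a.
Proof.
move=> ra; split; first by move=> i; case: (ra i).
have /choice[f fP] i : exists e, 0 < e /\ forall d, enorm d < e ->
    (forall o, orth_compl (C i) (submxcol a i) o -> inner o d = 0) -> C i (submxcol a i + d).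
  by have [_ [e e0 h]] := ra i; exists e.
have [e e0 ef] := finite_lower_bound (fun i => (fP i).1).
exists e => // d de ov i; rewrite submxcolD; apply: (fP i).2.
  by apply: le_lt_trans (enorm_submxcol _ _) _; apply: lt_le_trans de (ef i).
move=> o oo; have h w : inner (update 0 o) w = inner o (submxcol w i).
  have := inner_update_diff w 0 o; rewrite submxcol0 !subr0 => hw.
  by rewrite innerC hw innerC.
rewrite -h; apply: ov => u Cu; rewrite h submxcolB; exact: oo.
Qed.

Lemma cone_reducible_holder n (A : 'M[R]_(N, n)) xs alpha :
  0 < alpha <= 1 -> (forall i, econvex (C i)) -> prodset (A *m xs) ->
  (forall i, cone_reducible alpha (C i)) -> normal_holder prodset A xs alpha.
Proof.
move=> ha vC Cb red; set b := A *m xs in Cb *.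
have /choice[f fP] i : exists f : R * R, [/\ 0 < f.2, 0 <= f.1 &
    forall p y : 'cV[R]_(m i), C i p -> enorm (p - submxcol b i) < f.2 ->
    normal_cone (C i) p y -> exists2 w, normal_cone (C i) (submxcol b i) w &
    enorm (y - w) <= f.1 * enorm y * powR (enorm (p - submxcol b i)) alpha].
  have [c [r h]] := cone_reducible_normal ha (vC i) (Cb i) ((red i).2 _ (Cb i)).
  by exists (c, r).
have [r r0 rf] : exists2 r, 0 < r & forall i, r <= (f i).2.
  by apply: finite_lower_bound => i; case: (fP i).
exists (\sum_i (f i).1), r; split=> //; first by apply: sumr_ge0 => i _; case: (fP i).
move=> p y Cp pr Ny.
pose Q i := [set w | normal_cone (C i) (submxcol b i) w /\
    enorm (submxcol y i - w) <= (f i).1 * enorm (submxcol y i) *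
      powR (enorm (submxcol p i - submxcol b i)) alpha].
pose w i := xget 0 (Q i).
have wP i : Q i (w i).
  rewrite /w; case: xgetP => // h; have [_ _ H] := fP i.
  have [|w' Nw wle] := H (submxcol p i) (submxcol y i) (Cp i) _ (@normal_cone_unstack p y Cp Ny i).
    rewrite -submxcolB; apply: le_lt_trans (enorm_submxcol _ _) _.
    exact: lt_le_trans pr (rf i).
  by case: (h w').
exists (stack w).
  by apply: normal_cone_stack => i; rewrite stackK; case: (wP i).
apply: le_trans (enorm_stack_le _) _; rewrite mulr_suml mulr_suml; apply: ler_sum => i _.
have [_ wle] := wP i; have [_ f0 _] := fP i; rewrite submxcolB stackK.
apply: le_trans wle _; apply: ler_pM; rewrite ?mulr_ge0 ?powR_ge0 //.
  by rewrite ler_wpM2l // enorm_submxcol.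
have /andP[a0 _] := ha; apply: ge0_ler_powR; rewrite ?nnegrE ?(ltW a0) //.
by rewrite -submxcolB enorm_submxcol.
Qed.

End Stacking.

(** * The dual function and the algorithm *)

Section Convergence.
Variable R : realType.

Lemma sum_ord_telescope (V : zmodType) (l : nat) (F : nat -> V) :
  \sum_(i < l) (F i.+1 - F i) = F l - F 0%N.
Proof. by rewrite -(telescope_sumr F (leq0n l)) big_mkord. Qed.

Lemma telescope_bound n (l : nat) (F : nat -> 'cV[R]_n) (j : 'I_l) :
  enorm (F j - F l) <= \sum_(i < l) enorm (F i.+1 - F i).
Proof.
suff H k : enorm (F j - F (j + k)%N) <= \sum_(i < j + k) enorm (F i.+1 - F i).
  by have := H (l - j)%N; rewrite subnKC // ltnW.
elim: k => [|k IH]; first by rewrite addn0 subrr enorm0 sumr_ge0.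
rewrite addnS big_ord_recr /= (enormBC (F (j + k).+1)).
by apply: le_trans (enorm_tri _ (F (j + k)%N) _) _; rewrite lerD2r.
Qed.

Lemma cvg_enorm n (x : nat -> 'cV[R]_n) xs :
  (forall e, 0 < e -> exists T, forall t, (T <= t)%N -> enorm (x t - xs) < e) ->
  x @ \oo --> xs.
Proof.
move=> H; apply/cvgrPdist_lt => e e0; have [T TP] := H e e0.
exists T => // t /= /TP; apply: le_lt_trans.
by rewrite distrC mx_norm_le_enorm.
Qed.

Lemma cvge0_le (f : nat -> \bar R) : (forall t, 0 <= f t)%E ->
  (forall e, 0 < e -> exists T, forall t, (T <= t)%N -> (f t <= e%:E)%E) ->
  f @ \oo --> 0%E.
Proof.
move=> f0 H.
have fin t e : (f t <= e%:E)%E -> f t \is a fin_num.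
  by move=> h; rewrite ge0_fin_numE // (le_lt_trans h) // ltry.
apply/fine_cvgP; split.
  by have [T TP] := H 1 ltr01; exists T => // t /= /TP /fin.
apply/cvgrPdist_le => e e0; have [T TP] := H e e0.
exists T => // t /= /TP h; rewrite sub0r normrN ger0_norm ?fine_ge0 //.
by rewrite -lee_fin fineK // (fin _ _ h).
Qed.

End Convergence.

(** * Values of the dual function and duality *)

Section DualFunction.
Variable R : realType.

Lemma supp_fun_ge k (C : set 'cV[R]_k) y u : C u -> ((inner y u)%:E <= supp_fun C y)%E.
Proof. by move=> Cu; apply: ereal_sup_ubound; exists u. Qed.

Lemma supp_fun_normal k (C : set 'cV[R]_k) y p : C p -> normal_cone C p y ->
  supp_fun C y = (inner y p)%:E.
Proof.
move=> Cp Ny; apply/le_anti; rewrite supp_fun_ge // andbT.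
apply: ge_ereal_sup => _ [u Cu <-]; rewrite lee_fin.
by have := Ny _ Cu; rewrite innerBr subr_le0.
Qed.

Variables (l n : nat) (m : 'I_l -> nat) (C : forall i, set 'cV[R]_(m i)).
Arguments C : clear implicits.
Variables (A : forall i, 'M[R]_(m i, n)) (v : 'cV[R]_n).
Implicit Type w : 'cV[R]_n.
Arguments A : clear implicits.

Definition stack_mx : 'M[R]_((\sum_i m i)%N, n) := \mxcol_i A i.

Lemma submxcol_stack_mx w i : submxcol (stack_mx *m w) i = A i *m w.
Proof. by rewrite -submxcol_mul mxcolK. Qed.

Lemma prodset_stack_mx w : prodset C (stack_mx *m w) <-> forall i, C i (A i *m w).
Proof. by split => h i; have := h i; rewrite submxcol_stack_mx. Qed.

Lemma tr_stack_mx (u : 'cV[R]_(\sum_i m i)%N) : stack_mx^T *m u = \sum_i (A i)^T *m submxcol u i.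
Proof. by rewrite -{1}(submxcolK u) tr_mxcol mul_mxrow_mxcol. Qed.

Let q (y : forall i, 'cV[R]_(m i)) :=
  2^-1 * enorm (\sum_i (A i)^T *m y i - v) ^+ 2 - 2^-1 * enorm v ^+ 2.

Lemma dual_fun_ge (y u : forall i, 'cV[R]_(m i)) : (forall i, C i (u i)) ->
  ((q y + \sum_i inner (y i) (u i))%:E <= dual_fun A C v y)%E.
Proof.
move=> Cu; rewrite EFinD /dual_fun leeD2l // -sumEFin; apply: lee_sum => i _.
exact: supp_fun_ge.
Qed.

Lemma dual_fun_normal (y p : forall i, 'cV[R]_(m i)) : (forall i, C i (p i)) -> (forall i, normal_cone (C i) (p i) (y i)) ->
  dual_fun A C v y = (q y + \sum_i inner (y i) (p i))%:E.
Proof.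
move=> Cp Ny; rewrite EFinD /dual_fun -sumEFin; congr (_ + _)%E.
by apply: eq_bigr => i _; exact: supp_fun_normal.
Qed.

Variable xs : 'cV[R]_n.
Hypothesis Cxs : forall i, C i (A i *m xs).

Lemma sum_delta_ind w : (\sum_(i < l) delta_ind (mxpre (A i) (C i)) w)%E =
  if `[< forall i, C i (A i *m w) >] then 0%E else +oo%E :> \bar R.
Proof.
case: asboolP => [h|/existsNP[i h]].
  by apply: big1 => i _; rewrite /delta_ind asboolT //; exact: h.
rewrite (bigD1 i) //= {1}/delta_ind asboolF // addye // -ltNye.
apply: lt_le_trans (_ : 0 <= _)%E; first exact: ltNy0.
by apply: sume_ge0 => j _; rewrite /delta_ind; case: ifP.
Qed.

(** The sum of indicators is the indicator of the feasible set, whose subdifferential is the normal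
    cone. *)
Lemma subdiff_preimage_normal :
  subdiff (fun w => (\sum_(i < l) delta_ind (mxpre (A i) (C i)) w)%E) xs =
  preimage_normal (prodset C) stack_mx xs.
Proof.
apply/seteqP; split => [g [_ h] w /prodset_stack_mx Cw|g Ng].
  have := h w; rewrite !sum_delta_ind !asboolT // add0e lee_fin.
  by [].
split=> [|w]; first by rewrite sum_delta_ind asboolT.
rewrite !sum_delta_ind asboolT // add0e; case: asboolP => [Cw|_]; last exact: leey.
by rewrite lee_fin; apply: Ng; apply/prodset_stack_mx.
Qed.

Lemma dual_fun_solution yb : dual_solutions (prodset C) stack_mx xs v yb ->
  dual_fun A C v (fun i => submxcol yb i) =
  (2^-1 * inner xs xs + inner (v - xs) xs - 2^-1 * enorm v ^+ 2)%:E.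
Proof.
move=> [Nyb ybE]; rewrite (@dual_fun_normal _ (fun i => A i *m xs)) //; last first.
  move=> i; rewrite -submxcol_stack_mx; apply: normal_cone_unstack Nyb i.
  exact/prodset_stack_mx.
rewrite /q -tr_stack_mx ybE; congr (_%:E).
have -> : \sum_i inner (submxcol yb i) (A i *m xs) = inner (v - xs) xs.
  rewrite -ybE (innerC _ xs) -inner_mulmxl innerC inner_stack.
  by apply: eq_bigr => i _; rewrite submxcol_stack_mx.
have -> : v - xs - v = - xs by apply/colP => i; rewrite !mxE; ring.
by rewrite enormN (enorm_sqr xs); ring.
Qed.

(** Weak duality: bounding each support function below at [A i *m xs] leaves the square |w - v +
    xs|^2 / 2. *)
Lemma dual_fun_lower (y : forall i, 'cV[R]_(m i)) : ((2^-1 * inner xs xs + inner (v - xs) xs - 2^-1 * enorm v ^+ 2)%:E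
  <= dual_fun A C v y)%E.
Proof.
apply: le_trans (dual_fun_ge y Cxs); rewrite lee_fin /q.
set w := \sum_i (A i)^T *m y i.
have -> : \sum_i inner (y i) (A i *m xs) = inner w xs.
  rewrite innerC inner_sumr; apply: eq_bigr => i _.
  by rewrite innerC inner_mulmxl.
have := inner_ge0 (w - v + xs); rewrite inner_sqD (enorm_sqr (w - v)).
rewrite (innerBl w v xs) (innerBl v xs xs); lra.
Qed.

Lemma dual_value yb : dual_solutions (prodset C) stack_mx xs v yb ->
  ereal_inf (range (dual_fun A C v)) =
  (2^-1 * inner xs xs + inner (v - xs) xs - 2^-1 * enorm v ^+ 2)%:E.
Proof.
move=> Myb; apply/le_anti/andP; split.
  by rewrite -(dual_fun_solution Myb); apply: ereal_inf_lbound; exists (fun i => submxcol yb i).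
by apply: le_ereal_inf_tmp => _ [y _ <-]; exact: dual_fun_lower.
Qed.

End DualFunction.

(** * One sweep of the algorithm: invariants, descent and residual *)

Section Algorithm.
Variable R : realType.
Variables (l n : nat) (m : 'I_l -> nat) (C : forall i, set 'cV[R]_(m i)).
Arguments C : clear implicits.
Variables (A : forall i, 'M[R]_(m i, n)) (v : 'cV[R]_n).
Arguments A : clear implicits.
Variables (xin : nat -> nat -> 'cV[R]_n) (y : nat -> forall i, 'cV[R]_(m i)).
Arguments y : clear implicits.
Let gam i := lambda_max ((A i)^T *m A i).
Hypothesis n0 : (0 < n)%N.
Hypothesis A0 : forall i, A i != 0.
Hypothesis C0 : forall i, C i !=set0.
Hypothesis cC : forall i, eclosed (C i).
Hypothesis vC : forall i, econvex (C i).
Hypothesis y0 : forall i, y 0%N i = 0.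
Hypothesis xin0 : xin 0%N l = v.
Hypothesis xinS : forall t, xin t.+1 0%N = xin t l.
Let p t i := proj_set (C i) (gam i *: y t i + A i *m xin t.+1 i).
Hypothesis xin_rec : forall t (i : 'I_l), xin t.+1 i.+1 =
  (1%:M - (gam i)^-1 *: ((A i)^T *m A i)) *m xin t.+1 i +
  (gam i)^-1 *: ((A i)^T *m p t i).
Hypothesis y_rec : forall t i, y t.+1 i =
  y t i + (gam i)^-1 *: (A i *m xin t.+1 i) - (gam i)^-1 *: p t i.

Let gam0 i : 0 < gam i. Proof. exact: (lambda_maxP n0 (A0 i)).1. Qed.

Lemma prox_point t (i : 'I_l) : p t i = A i *m xin t.+1 i - gam i *: (y t.+1 i - y t i).
Proof.
by rewrite y_rec; apply/colP => j; rewrite !mxE; field; exact: lt0r_neq0 (gam0 i).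
Qed.

Lemma primal_step t (i : 'I_l) :
  xin t.+1 i.+1 = xin t.+1 i - (A i)^T *m (y t.+1 i - y t i).
Proof.
rewrite xin_rec mulmxBl mul1mx -scalemxAl -mulmxA y_rec.
have -> : y t i + (gam i)^-1 *: (A i *m xin t.+1 i) - (gam i)^-1 *: p t i - y t i =
    (gam i)^-1 *: (A i *m xin t.+1 i - p t i).
  by apply/colP => j; rewrite !mxE; ring.
rewrite -scalemxAr mulmxBr.
by apply/colP => j; rewrite !mxE; ring.
Qed.

Lemma prox_in t i : C i (p t i).
Proof.
rewrite /p /proj_set; case: xgetP => [q _ []//|h].
have [q qP] := is_proj_exists (gam i *: y t i + A i *m xin t.+1 i) (C0 i) (@cC i).
by case: (h q).
Qed.

(** The new dual block is a positive multiple of a projection residual. *)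
Lemma prox_normal t i : normal_cone (C i) (p t i) (y t.+1 i).
Proof.
have pP : is_proj (C i) (gam i *: y t i + A i *m xin t.+1 i) (p t i).
  rewrite /p /proj_set; case: xgetP => [q _ //|h].
  have [q qP] := is_proj_exists (gam i *: y t i + A i *m xin t.+1 i) (C0 i) (@cC i).
  by case: (h q).
have -> : y t.+1 i = (gam i)^-1 *: (gam i *: y t i + A i *m xin t.+1 i - p t i).
  by rewrite y_rec; apply/colP => j; rewrite !mxE; field; exact: lt0r_neq0 (gam0 i).
apply: normal_coneZ; first by rewrite invr_ge0 ltW.
by apply: is_proj_variational pP.
Qed.

Let AS := stack_mx A.
Let Y t := stack (y t).
(** Points where the support functions are attained at [Y t]. As [y 0] vanishes, any point of [C i]
    serves at time 0. *)
Let P t := stack (fun i => if t is t'.+1 then p t' i else xget 0 (C i)).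

Lemma primal_dual t : AS^T *m Y t = v - xin t l.
Proof.
elim: t => [|t IH].
  by rewrite tr_stack_mx xin0 subrr big1 // => i _; rewrite stackK y0 mulmx0.
have := @sum_ord_telescope _ l (xin t.+1).
have -> : \sum_(i < l) (xin t.+1 i.+1 - xin t.+1 i) = AS^T *m Y t - AS^T *m Y t.+1.
  rewrite !tr_stack_mx -sumrB; apply: eq_bigr => i _.
  by rewrite primal_step !stackK mulmxBr addrAC subrr add0r opprB.
rewrite IH xinS => h; apply/eqP; rewrite -subr_eq0; apply/eqP.
move: h; set w := AS^T *m _ => h.
have -> : w - (v - xin t.+1 l) = - (v - xin t l - w) + (xin t.+1 l - xin t l).
  by apply/colP => j; rewrite !mxE; ring.
by rewrite h addNr.
Qed.

Lemma P_in t i : C i (submxcol (P t) i).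
Proof.
rewrite stackK; case: t => [|t]; last exact: prox_in.
by have [c Cc] := C0 i; apply: (@xgetPex _ 0); exists c.
Qed.

Lemma P_normal t i : normal_cone (C i) (submxcol (P t) i) (y t i).
Proof.
rewrite stackK; case: t => [|t]; last exact: prox_normal.
by rewrite y0; exact: normal_cone0.
Qed.

Lemma inner_stack_P t : inner (Y t) (P t) = \sum_i inner (y t i) (submxcol (P t) i).
Proof. by rewrite inner_stack; apply: eq_bigr => i _; rewrite stackK. Qed.

Let S t := enorm (Y t.+1 - Y t).

Lemma step_le t i : enorm (y t.+1 i - y t i) <= S t.
Proof. by have := enorm_submxcol (Y t.+1 - Y t) i; rewrite submxcolB !stackK. Qed.

(** With d the change of the block, the right side is gam |d|^2 - |A^T d|^2 / 2 + <y_i^t, P_i^t -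
    P_i^{t+1}>. The last term is nonnegative by normality, and |A^T d|^2 <= gam |d|^2 by the choice
    of [gam]. *)
Lemma block_descent t (i : 'I_l) :
  gam i / 2 * enorm (y t.+1 i - y t i) ^+ 2 <=
  2^-1 * inner (xin t.+1 i) (xin t.+1 i) - 2^-1 * inner (xin t.+1 i.+1) (xin t.+1 i.+1)
  + (inner (y t i) (submxcol (P t) i) - inner (y t.+1 i) (submxcol (P t.+1) i)).
Proof.
have h1 := @P_normal t i _ (P_in t.+1 i).
have := (lambda_maxP n0 (A0 i)).2 (y t.+1 i - y t i); rewrite -/(gam i).
move: h1; rewrite innerBr primal_step [submxcol (P t.+1) i]stackK prox_point.
set d := y t.+1 i - y t i.
have -> : y t.+1 i = y t i + d by rewrite subrKC.
move: (xin t.+1 i) (y t i) (submxcol (P t) i) d => w a q d.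
rewrite inner_sqB !innerBr !innerDl !innerZr !enorm_sqr.
rewrite (innerC w (_ *m d)) (inner_mulmxl _ d w) trmxK; lra.
Qed.

Lemma descent_gap : exists2 c1, 0 < c1 & forall t, c1 * S t ^+ 2 <=
  (2^-1 * inner (xin t l) (xin t l) + inner (Y t) (P t)) -
  (2^-1 * inner (xin t.+1 l) (xin t.+1 l) + inner (Y t.+1) (P t.+1)).
Proof.
have [c c0 cle] := finite_lower_bound (fun i => divr_gt0 (gam0 i) (ltr0Sn R 1)).
exists c => // t.
have -> : S t ^+ 2 = \sum_i enorm (y t.+1 i - y t i) ^+ 2.
  rewrite enorm_sqr inner_stack; apply: eq_bigr => i _.
  by rewrite submxcolB !stackK enorm_sqr.
rewrite [leLHS]mulr_sumr.
apply: le_trans (ler_sum _ (fun i _ => le_trans _ (block_descent t i))) _.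
  by move=> i _; rewrite ler_wpM2r ?sqr_ge0.
have T := @sum_ord_telescope _ l (fun j => 2^-1 * inner (xin t.+1 j) (xin t.+1 j)).
rewrite big_split /= [X in _ + X]sumrB -!inner_stack_P.
have -> : \sum_(i < l) (2^-1 * inner (xin t.+1 i) (xin t.+1 i)
    - 2^-1 * inner (xin t.+1 i.+1) (xin t.+1 i.+1)) =
    - (2^-1 * inner (xin t.+1 l) (xin t.+1 l) - 2^-1 * inner (xin t.+1 0) (xin t.+1 0)).
  by rewrite -T -sumrN; apply: eq_bigr => i _; rewrite opprB.
rewrite xinS; lra.
Qed.

(** Block [i] is projected at the intermediate point [xin t.+1 i]; the drift to the end of the sweep
    telescopes into the later dual steps. *)
Lemma residual_bound : exists2 c2, 0 <= c2 & forall t,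
  enorm (P t.+1 - AS *m xin t.+1 l) <= c2 * S t.
Proof.
have /choice[K KP] i : exists K, 0 <= K /\ forall w, enorm (A i *m w) <= K * enorm w.
  by have [K K0 h] := mulmx_bound (A i); exists K.
have /choice[K' KP'] i : exists K, 0 <= K /\ forall w, enorm ((A i)^T *m w) <= K * enorm w.
  by have [K0 h h'] := mulmx_bound (A i)^T; exists K0.
have s0 : 0 <= \sum_i K' i by apply: sumr_ge0 => i _; case: (KP' i).
exists (\sum_i (K i * \sum_j K' j + gam i)).
  apply: sumr_ge0 => i _; rewrite addr_ge0 ?(ltW (gam0 i)) // mulr_ge0 //.
  by case: (KP i).
move=> t; apply: le_trans (enorm_stack_le _) _; rewrite mulr_suml; apply: ler_sum => i _.
rewrite submxcolB submxcol_stack_mx stackK prox_point.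
have -> : A i *m xin t.+1 i - gam i *: (y t.+1 i - y t i) - A i *m xin t.+1 l =
   A i *m (xin t.+1 i - xin t.+1 l) - gam i *: (y t.+1 i - y t i).
  by rewrite mulmxBr addrAC.
apply: le_trans (enormB _ _) _; rewrite mulrDl; apply: lerD; last first.
  by rewrite enormZ gtr0_norm // ler_pM2l // step_le.
apply: le_trans ((KP i).2 _) _; rewrite -mulrA ler_wpM2l ?(KP i).1 //.
apply: le_trans (telescope_bound _ _) _; rewrite mulr_suml; apply: ler_sum => j _.
rewrite primal_step addrAC subrr add0r enormN.
by apply: le_trans ((KP' j).2 _) _; rewrite ler_wpM2l ?(KP' j).1 // step_le.
Qed.

End Algorithm.

Lemma relint_image_ri (R : realType) (l n : nat) (m : 'I_l -> nat)
    (C : forall i : 'I_l, set 'cV[R]_(m i)) (A : forall i : 'I_l, 'M[R]_(m i, n)) z :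
  (forall i, ri (C i) (A i *m z)) -> relint (prodset C) (stack_mx A *m z).
Proof.
by move=> riz; apply: relint_stack => i; rewrite submxcol_stack_mx; apply/ri_relint/riz.
Qed.

Unset Implicit Arguments.

Theorem theorem5p3 (R : realType) (l n : nat) (m : 'I_l -> nat)
  (C : forall i : 'I_l, set 'cV[R]_(m i))
  (A : forall i : 'I_l, 'M[R]_(m i, n))
  (vbar xstar : 'cV[R]_n) (alpha : R)
  (x : nat -> 'cV[R]_n)
  (xin : nat -> nat -> 'cV[R]_n)
  (y : nat -> forall i : 'I_l, 'cV[R]_(m i)) :
  (1 <= l)%N -> (0 < n)%N -> (forall i, (0 < m i)%N) ->
  (forall i, C i !=set0 /\ closed (C i) /\ convex_set (C i)) ->
  (forall i, A i != 0) ->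
  (\bigcap_(i in [set: 'I_l]) mxpre (A i) (C i)) !=set0 ->
  (* x* is the solution of min 1/2 ||x - vbar||^2 s.t. A_i x in C_i *)
  (forall i, C i (A i *m xstar)) ->
  (forall z : 'cV[R]_n, (forall i, C i (A i *m z)) ->
     2^-1 * enorm (xstar - vbar) ^+ 2 <= 2^-1 * enorm (z - vbar) ^+ 2) ->
  (* (a) *)
  0 < alpha <= 1 -> (forall i, cone_reducible alpha (C i)) ->
  (* (b) *)
  (\bigcap_(i in [set: 'I_l]) mxpre (A i) (ri (C i))) !=set0 ->
  (* (c) *)
  (exists g, ri (subdiff (fun z => (\sum_(i < l) delta_ind (mxpre (A i) (C i)) z)%E) xstar) g
             /\ xstar - vbar + g = 0) ->
  (* the algorithm *)
  (forall i, y 0%N i = 0) ->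
  x 0%N = vbar -> xin 0%N l = vbar ->
  (forall t, xin t.+1 0%N = xin t l) ->
  (forall t (i : 'I_l),
     xin t.+1 i.+1 =
       (1%:M - (lambda_max ((A i)^T *m A i))^-1 *: ((A i)^T *m A i)) *m xin t.+1 i
       + (lambda_max ((A i)^T *m A i))^-1 *:
           ((A i)^T *m proj_set (C i) (lambda_max ((A i)^T *m A i) *: y t i + A i *m xin t.+1 i))) ->
  (forall t (i : 'I_l),
     y t.+1 i =
       y t i + (lambda_max ((A i)^T *m A i))^-1 *: (A i *m xin t.+1 i)
       - (lambda_max ((A i)^T *m A i))^-1 *:
           proj_set (C i) (lambda_max ((A i)^T *m A i) *: y t i + A i *m xin t.+1 i)) ->
  (forall t, x t.+1 = xin t.+1 l) ->
  let d := dual_fun A C vbar in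
  let dstar := ereal_inf (range d) in
  let Argmin := [set w | d w = dstar] in
  (x @ \oo --> xstar) /\
  ((fun t => ydist (y t) Argmin) @ \oo --> 0%E) /\
  (* (i) *)
  ((forall i, cone_reducible 1 (C i)) ->
     exists ystar a1 a0 tbar, Argmin ystar /\ 0 < a1 /\ 0 < a0 < 1 /\ (0 < tbar)%N /\
       forall t, (tbar <= t)%N ->
         enorm (x t - xstar) <= a1 * a0 ^+ t /\
         ynorm (fun i => y t i - ystar i) <= a1 * a0 ^+ t) /\
  (* (ii) *)
  (forall beta : R, 0 < beta < 1 -> (forall i, cone_reducible beta (C i)) ->
     let theta := (1 + beta)^-1 in
     let r := (1 - theta) / (2 * theta - 1) in
     exists a1 tbar, 0 < a1 /\ (0 < tbar)%N /\
       forall t, (tbar <= t)%N ->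
         enorm (x t - xstar) <= a1 * powR t%:R (- (beta / 2 * r)) /\
         (d (y t) - dstar <= (a1 * powR t%:R (- r))%:E)%E /\
         (ydist (y t) Argmin <= (a1 * powR t%:R (- (beta / 2 * r)))%:E)%E).
Proof.
move=> _ n0 _ hC A0 _ Cxs _ ha red [z riz] [g [rig gE]] y0 x0 xin0 xinS xin_rec y_rec xS.
move=> d dstar Argmin.
have C0 i : C i !=set0 by case: (hC i).
have cC i : eclosed (C i) by have [_ [c _]] := hC i; exact: closed_eclosed.
have vC i : econvex (C i) by have [_ [_ c]] := hC i; exact: convex_set_econvex.
have xE t : x t = xin t l by case: t => [|t]; [rewrite x0 xin0 | rewrite xS].
pose CS := prodset C; pose AS := stack_mx A.
have vCS : econvex CS by exact: prodset_econvex.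
have rizS : relint CS (AS *m z) by apply: relint_image_ri => i; exact: riz.
have CxsS : CS (AS *m xstar) by apply/prodset_stack_mx.
have rib : relint (preimage_normal CS AS xstar) (vbar - xstar).
  have -> : vbar - xstar = g.
    have -> : g = (xstar - vbar + g) + (vbar - xstar).
      by apply/colP => i; rewrite !mxE; ring.
    by rewrite gE add0r.
  by apply: ri_relint; rewrite -subdiff_preimage_normal.
pose Y t := stack (y t).
pose P t := stack (fun i => if t is t'.+1 then
  proj_set (C i) (lambda_max ((A i)^T *m A i) *: y t' i + A i *m xin t'.+1 i)
  else xget 0 (C i)).
have CP t : CS (P t).
  by move=> i; exact: (P_in A xin y C0 cC).
have NP t : normal_cone CS (P t) (Y t).
  apply: normal_cone_stack => i; rewrite [submxcol (Y t) i]stackK.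
  exact: (P_normal n0 A0 C0 cC vC y0 y_rec).
have XE t : AS^T *m Y t = vbar - x t.
  by rewrite xE; exact: (primal_dual y0 xin0 xinS xin_rec y_rec).
pose dst := 2^-1 * inner xstar xstar + inner (vbar - xstar) xstar.
pose D t := 2^-1 * inner (x t) (x t) + inner (Y t) (P t) - dst.
have [c1 c10 descent] : exists2 c1, 0 < c1 & forall t,
    c1 * enorm (Y t.+1 - Y t) ^+ 2 <= D t - D t.+1.
  have [c1 c10 h] := descent_gap n0 A0 C0 cC vC y0 xinS xin_rec y_rec.
  have E (a b e : R) : a - e - (b - e) = a - b by ring.
  by exists c1 => // t; rewrite /D !xE E; exact: h.
have [c2 c20 residual] := residual_bound n0 A0 xin_rec y_rec.
have {}residual t : enorm (P t.+1 - AS *m x t.+1) <= c2 * enorm (Y t.+1 - Y t).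
  by rewrite xE; exact: residual.
have holder beta : 0 < beta <= 1 -> (forall i, cone_reducible beta (C i)) ->
    normal_holder CS AS xstar beta.
  by move=> hb; exact: cone_reducible_holder.
have DE t : D t = 2^-1 * inner (x t) (x t) + inner (Y t) (P t) -
  (2^-1 * inner xstar xstar + inner (vbar - xstar) xstar) by [].
(* One dual solution suffices to identify the optimal value. *)
have [B _ /(_ 0%N) [yb0 Myb0 _]] :=
  dual_solution_near vCS rizS CxsS rib NP XE DE c10 descent.
have dstarE : dstar = (dst - 2^-1 * enorm vbar ^+ 2)%:E := dual_value Cxs Myb0.
have dyE t : d (y t) = (D t + (dst - 2^-1 * enorm vbar ^+ 2))%:E.
  rewrite /d (@dual_fun_normal _ _ _ _ _ _ _ _ (fun i => submxcol (P t) i)); last 2 first.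
  - by move=> i; exact: CP.
  - by move=> i; exact: (P_normal n0 A0 C0 cC vC y0 y_rec).
  have -> : \sum_i (A i)^T *m y t i - vbar = - x t.
    have := XE t; rewrite tr_stack_mx; under eq_bigr do rewrite stackK.
    by move=> ->; rewrite addrAC subrr add0r.
  rewrite enormN (enorm_sqr (x t)) DE -inner_stack_P /P /Y /dst; congr (_%:E); ring.
have solArg yb : dual_solutions CS AS xstar vbar yb -> Argmin (fun i => submxcol yb i).
  by move=> Myb; rewrite /Argmin /= dstarE; exact: (dual_fun_solution Cxs Myb).
have ynormE t yb : ynorm (fun i => y t i - submxcol yb i) = enorm (Y t - yb).
  rewrite ynorm_stack; congr enorm; rewrite -[RHS]submxcolK; congr stack.
  by apply: functional_extensionality_dep => i; rewrite submxcolB stackK.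
have ydist_le t yb e : dual_solutions CS AS xstar vbar yb -> enorm (Y t - yb) <= e ->
    (ydist (y t) Argmin <= e%:E)%E.
  move=> Myb h; apply: le_trans (_ : (ynorm (fun i => y t i - submxcol yb i))%:E <= _)%E.
    by apply: ereal_inf_lbound; exists (fun i => submxcol yb i) => //; exact: solArg.
  by rewrite lee_fin ynormE.
split.
  by apply: cvg_enorm; exact: (primal_cvg vCS rizS CxsS rib CP NP XE DE c10 c20 descent residual).
split.
  apply: cvge0_le => [t|e e0].
    by apply: le_ereal_inf_tmp => _ [w _ <-]; rewrite lee_fin /ynorm sqrtr_ge0.
  have [T TP] := dual_cvg vCS rizS CxsS rib CP NP XE DE c10 c20 descent residual ha
    (holder _ ha red) e0.
  by exists T => t /TP [yb Myb /ltW h]; exact: ydist_le Myb h.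
split.
  move=> red1; have h1 : 0 < (1 : R) <= 1 by rewrite (@ltr01 R) (@lexx _ R).
  have [ys [a1 [a0 [T [Mys a10 a01 H]]]]] :=
    linear_cvg vCS rizS CxsS rib CP NP XE DE c10 c20 descent residual (holder _ h1 red1).
  (* [T.+1], because the threshold has to be positive. *)
  exists (fun i => submxcol ys i), a1, a0, T.+1; split; first exact: solArg.
  do 3 (split => //); move=> t Tt; have [hx hy] := H t (ltnW Tt).
  by split => //; rewrite ynormE.
move=> beta /andP[b0 b1] redb theta r.
have hb : 0 < beta <= 1 by rewrite b0 ltW.
have b01 : 0 < beta < 1 by rewrite b0.
have [a [T [a0 H]]] :=
  sublinear_cvg vCS rizS CxsS rib CP NP XE DE c10 c20 descent residual b01 (holder _ hb redb).
have rE : r = beta / (1 - beta).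
  rewrite /r /theta; field; apply/andP; split; apply/lt0r_neq0; lra.
rewrite rE; exists a, T.+1; do 2 (split => //); move=> t Tt.
have [hx hD [yb Myb hy]] := H t (ltnW Tt); split => //; split.
  by rewrite dyE dstarE -EFinB lee_fin addrK.
exact: ydist_le Myb hy.
Qed.
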